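(* In the setting described in the context (data $G,U,T,X,\mu,\nu,\mathcal A,(S_d),d_o,T_+,\rho$ satisfying (S1)-(S6), (EQ1) and (EQ2)), for every $r\ge1$ there exist $d_r\in\mathbb N$ and $D_r,\delta_r>0$ such that $$\Big|\nu\Big(\varphi_o\prod_{i=1}^r\varphi_i\circ t_i\Big)-\nu(\varphi_o)\prod_{i=1}^r\mu(\varphi_i)\Big|\le D_r\,\Delta_r(\underline t)^{-\delta_r}\,\|\varphi_o\|_{W(\nu)}\prod_{i=1}^rS_{d_r}(\varphi_i)$$ for all $\underline t=(t_1,\dots,t_r)\in T_+^r$, $\varphi_o\in W(\nu)$ and $\varphi_1,\dots,\varphi_r\in\mathcal A$.
   Context: Setting. $G$ is a real Lie group, $U$ a closed connected subgroup with Lie algebra $\mathfrak u$, and $T$ a closed connected abelian subgroup of $G$ normalizing $U$ such that the adjoint action of $T$ on $\mathfrak u$ is proper (the map $T\to\mathrm{GL}(\mathfrak u)$ is proper) and diagonalizable (over $\mathbb R$). $\|\cdot\|$ is a fixed norm on $\mathfrak u$. $X$ is a standard Borel space with a measurable action of $G$, $\mu$ is a $G$-invariant probability measure on $X$, and $\nu$ is a $U$-invariant and $U$-ergodic probability measure on $X$. For a function $\varphi$ on $X$ and $g\in G$, $\varphi\circ g$ is $x\mapsto\varphi(gx)$; $\nu(\varphi)=\int\varphi\,d\nu$, similarly for $\mu$. Discrete spectrum. There are a set $\Xi$ of unitary characters of $\mathfrak u$ (continuous homomorphisms from the additive group $\mathfrak u$ to the unit circle) and an orthonormal basis $\{\psi_\xi:\xi\in\Xi\}$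 of $L^2(\nu)$ with $\psi_\xi\circ\exp(w)=\xi(w)\psi_\xi$ in $L^2(\nu)$ for all $\xi\in\Xi$, $w\in\mathfrak u$, and $\psi_1=1$. This basis is fixed. Let $B(X)$ be the $*$-algebra of bounded complex measurable functions on $X$, $\|\varphi\|_{W(\nu)}=\sum_{\xi\in\Xi}|\nu(\varphi\,\overline{\psi}_\xi)|$, and $W(\nu)=\{\varphi\in B(X):\|\varphi\|_{W(\nu)}<\infty\}$. Norms. $\mathcal A$ is a $G$-invariant sub-$*$-algebra of $B(X)$ with an increasing family of norms $S_1\le S_2\le\cdots$, invariant under complex conjugation ($S_d(\overline\varphi)=S_d(\varphi)$), such that for a fixed $d_o$ and all $d\ge 1$: (S1) $\|\varphi\|_\infty\le S_{d_o}(\varphi)$ for all $\varphi\in\mathcal A$. (S2) There are $A\ge1$, $a>0$ with $\|\varphi\circ\exp(w)-\varphi\|_\infty\le A\|w\|^aS_{d_o}(\varphi)$ for all $\varphi\in\mathcal A$, $w\in\mathfrak u$. (S3) There are $B_d\ge1$, $b_d>\max(1/2,a/4)$ with $S_d(\varphi\circ\exp(w))\le B_d\max(1,\|w\|)^{b_d}S_d(\varphi)$ for all $\varphi\in\mathcal A$, $w\in\mathfrak u$. (S4) There is $M_d\ge1$ with $S_d(\varphi_1\varphi_2)\le M_dS_{d+d_o}(\varphi_1)S_{d+d_o}(\varphi_2)$ for all $\varphi_1,\varphi_2\in\mathcal A$. (S5)-(S6) For all $q\ge1$, $\varphi_1,\dots,\varphi_q\in\mathcal A$ and compactly supported complex finite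 measures $\omega$ on $G^q$, $\phi:=\int_{G^q}\prod_{i=1}^q\varphi_i\circ g_i\,d\omega\in\mathcal A$ and $S_d(\phi)\le\int_{G^q}S_d\big(\prod_{i=1}^q\varphi_i\circ g_i\big)\,d|\omega|$. Equidistribution. (EQ1) There are $T_+\subset T$, $D_o\ge1$, $\delta_o\in(0,1)$ and $\rho:T_+\to[1,\infty)$ with $|\nu(\varphi\circ t)-\mu(\varphi)|\le D_o\,\rho(t)^{-\delta_o}S_{d_o}(\varphi)$ for all $\varphi\in\mathcal A$, $t\in T_+$. (EQ2) There are $C\ge1$, $0<c<1/2$ with $|\mu(\varphi_1\circ\exp(w)\cdot\varphi_2)-\mu(\varphi_1)\mu(\varphi_2)|\le C\max(1,\|w\|)^{-c}S_{d_o}(\varphi_1)S_{d_o}(\varphi_2)$ for all $\varphi_1,\varphi_2\in\mathcal A$, $w\in\mathfrak u$. Definition of $\Delta_r$. Fix an invariant metric $d$ on $T$ (the invariant distance associated with a norm on $\mathrm{Lie}(T)$). For $\underline t=(t_1,\dots,t_r)\in T_+^r$ put $\Delta_1(t_1)=\rho(t_1)$ and, for $r\ge2$, $\Delta_r(\underline t)=\min\big(\rho(t_1),\dots,\rho(t_r),\ \min_{i\ne j}\exp(d(t_i,t_j))\big)$. *)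

(* Defs.v *)
From HB Require Import structures.
From mathcomp Require Import all_boot all_order all_algebra.
From mathcomp Require Import all_classical all_reals all_analysis.
From mathcomp Require Import complex.

Set Implicit Arguments.
Unset Strict Implicit.
Unset Printing Implicit Defensive.

Import Order.TTheory GRing.Theory Num.Theory.
Import numFieldNormedType.Exports.
Import ComplexField.Normc.


Local Open Scope classical_set_scope.
Local Open Scope ring_scope.
Local Open Scope complex_scope.

HB.mixin Record isTopologicalGroup G & PointedTopological G & Group G := {
  mulg_continuous : continuous (fun p : G * G => (p.1 * p.2)%g);
  invg_continuous : continuous (fun x : G => (x^-1)%g)
}.

#[short(type="topologicalGroupType")]
HB.structure Definition TopologicalGroup :=
  {G of PointedTopological G & Group G & isTopologicalGroup G}.

(* [C_k k O f]: f is k times continuously (Frechet) differentiable on O. It is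
   only used for finite-dimensional V, where continuity of all the directional
   derivatives v |-> D_v f is continuity of the differential. *)
Fixpoint C_k (R : realType) (V W : normedModType R) (k : nat)
    (O : set V) (f : V -> W) : Prop :=
  match k with
  | 0%N => forall x, O x -> {for x, continuous f}
  | k'.+1 => (forall x, O x -> differentiable f x) /\
             (forall v, C_k k' O (fun x => 'D_v f x))
  end.

Definition smooth_on (R : realType) (V W : normedModType R)
  (O : set V) (f : V -> W) : Prop := forall k, C_k k O f.

Record chart (R : realType) (n : nat) (G : Type) := Chart {
  chart_dom : set G;
  chart_map :> G -> 'rV[R]_n;
  chart_inv : 'rV[R]_n -> G
}.

Definition chart_codom (R : realType) n (G : Type) (c : chart R n G) :
  set 'rV[R]_n := c @` chart_dom c.

(* The values of chart_map outside chart_dom, and of chart_inv outside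
   chart_codom, are irrelevant. *)
Record is_chart (R : realType) n (G : topologicalType) (c : chart R n G) :
    Prop := {
  chart_open_dom : open (chart_dom c);
  chart_open_codom : open (chart_codom c);
  chart_mapK : forall x, chart_dom c x -> chart_inv c (c x) = x;
  chart_map_continuous : forall x, chart_dom c x -> {for x, continuous c};
  chart_inv_continuous :
    forall y, chart_codom c y -> {for y, continuous (chart_inv c)}
}.

Record lie_group (R : realType) n (G : topologicalGroupType)
    (atlas : set (chart R n G)) : Prop := {
  lie_hausdorff : hausdorff_space G;
  lie_second_countable : @second_countable G;
  lie_chart : forall c, atlas c -> is_chart c;
  lie_cover : forall x : G, exists2 c, atlas c & chart_dom c x;
  lie_compatible : forall c1 c2, atlas c1 -> atlas c2 ->
    smooth_on (c1 @` (chart_dom c1 `&` chart_dom c2))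
      (fun v => c2 (chart_inv c1 v));
  lie_mul_smooth : forall c1 c2 c3, atlas c1 -> atlas c2 -> atlas c3 ->
    smooth_on
      [set p : 'rV[R]_n * 'rV[R]_n | [/\ chart_codom c1 p.1, chart_codom c2 p.2
        & chart_dom c3 (chart_inv c1 p.1 * chart_inv c2 p.2)%g]]
      (fun p => c3 (chart_inv c1 p.1 * chart_inv c2 p.2)%g);
  lie_inv_smooth : forall c1 c2, atlas c1 -> atlas c2 ->
    smooth_on
      [set v | chart_codom c1 v /\ chart_dom c2 ((chart_inv c1 v)^-1)%g]
      (fun v => c2 ((chart_inv c1 v)^-1)%g)
}.

Definition one_parameter_subgroup (R : realType) (G : topologicalGroupType)
    (gam : R -> G) : Prop :=
  continuous gam /\ forall s t, gam (s + t) = (gam s * gam t)%g.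

(* A chart c0 at the identity identifies Lie(G) = T_1 G with 'rV_n. Under this
   identification, s |-> exp (s v) is the unique one-parameter subgroup whose
   velocity at 0 is v. *)
Record exponential_map (R : realType) n (G : topologicalGroupType)
    (c0 : chart R n G) (expG : 'rV[R]_n -> G) : Prop := {
  exp_one_parameter :
    forall v, one_parameter_subgroup (fun s : R => expG (s *: v));
  exp_velocity : forall v,
    is_derive (0 : R) (1 : R) (fun s : R => c0 (expG (s *: v))) v;
  exp_unique : forall v (gam : R -> G), one_parameter_subgroup gam ->
    is_derive (0 : R) (1 : R) (fun s : R => c0 (gam s)) v -> gam 1 = expG v
}.

Definition is_subgroup (G : groupType) (H : set G) : Prop :=
  H 1%g /\ forall x y, H x -> H y -> H (x * y^-1)%g.

Definition lie_algebra (R : realType) n (G : Type) (expG : 'rV[R]_n -> G)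
    (H : set G) : set 'rV[R]_n :=
  [set v | forall s : R, H (expG (s *: v))].

(* The rows of B form a basis of Lie(H); w : 'rV_m is then the coordinate
   vector of the element w *m B of Lie(H). *)
Definition lie_algebra_basis (R : realType) n m (G : Type)
    (expG : 'rV[R]_n -> G) (H : set G) (B : 'M[R]_(m, n)) : Prop :=
  row_free B /\ forall v, (v <= B)%MS <-> lie_algebra expG H v.

Definition Ad (R : realType) n (G : groupType) (c0 : chart R n G)
    (expG : 'rV[R]_n -> G) (g : G) (v : 'rV[R]_n) : 'rV[R]_n :=
  derive1 (fun s : R => c0 (g * expG (s *: v) * g^-1)%g) 0.

(* Matrix of Ad g restricted to the row space of B, in the basis B, for the
   row vector convention: Ad g (w *m B) = (w *m Ad_mx g) *m B when the row
   space of B is stable under Ad g. *)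
Definition Ad_mx (R : realType) n m (G : groupType) (c0 : chart R n G)
    (expG : 'rV[R]_n -> G) (B : 'M[R]_(m, n)) (g : G) : 'M[R]_m :=
  \matrix_(i, j) (Ad c0 expG g (row i B) *m pinvmx B) 0 j.

(* Properness of T -> GL(u), where GL(u) is identified with the invertible
   matrices of size m = dim u. *)
Definition proper_on (R : realType) m (G : topologicalType) (T : set G)
    (rho : G -> 'M[R]_m) : Prop :=
  forall K : set 'M[R]_m, compact K -> (forall M, K M -> M \in unitmx) ->
    compact (T `&` rho @^-1` K).

Definition simultaneously_diagonalizable (R : realType) m (G : Type)
    (T : set G) (rho : G -> 'M[R]_m) : Prop :=
  exists2 P : 'M[R]_m, P \in unitmx &
    forall t, T t -> is_diag_mx (P *m rho t *m invmx P).

Definition is_norm (R : realType) k (N : 'rV[R]_k -> R) : Prop :=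
  [/\ forall v w, N (v + w) <= N v + N w,
      forall (a : R) v, N (a *: v) = `|a| * N v
    & forall v, N v = 0 -> v = 0].

(* d is the invariant distance on the connected abelian group T associated with
   the norm N on Lie(T): straight lines s |-> t1 exp(s v) are shortest paths for
   the corresponding invariant Finsler metric. *)
Record invariant_distance (R : realType) k (G : topologicalGroupType)
    (T : set G) (expT : 'rV[R]_k -> G) (N : 'rV[R]_k -> R) (d : G -> G -> R) :
    Prop := {
  dist_formula : forall t1 t2, T t1 -> T t2 ->
    d t1 t2 = inf [set N v | v in [set v | t2 = (t1 * expT v)%g]];
  dist_eq0 : forall t1 t2, T t1 -> T t2 -> d t1 t2 = 0 <-> t1 = t2;
  dist_sym : forall t1 t2, T t1 -> T t2 -> d t1 t2 = d t2 t1;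
  dist_triangle : forall t1 t2 t3, T t1 -> T t2 -> T t3 ->
    d t1 t3 <= d t1 t2 + d t2 t3;
  dist_invariant : forall t t1 t2, T t -> T t1 -> T t2 ->
    d (t * t1)%g (t * t2)%g = d t1 t2;
  dist_topology : forall t (V : set G), T t -> within T (nbhs t) V <->
    exists2 e : R, 0 < e & forall s, T s -> d t s < e -> V s
}.

Definition measurable_cfun (R : realType) d (X : measurableType d)
    (f : X -> R[i]) : Prop :=
  measurable_fun setT (fun x => complex.Re (f x)) /\
  measurable_fun setT (fun x => complex.Im (f x)).

Definition bounded_measurable (R : realType) d (X : measurableType d) :
    set (X -> R[i]) :=
  [set f | measurable_cfun f /\ exists M : R, forall x, normc (f x) <= M].

Definition supnorm (R : realType) (X : Type) (f : X -> R[i]) : R :=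
  sup (range (fun x => normc (f x))).

Definition cintegral (R : realType) d (X : measurableType d)
    (mu : {measure set X -> \bar R}) (f : X -> R[i]) : R[i] :=
  (\int[mu]_x complex.Re (f x)) +i* (\int[mu]_x complex.Im (f x)).

Definition square_integrable (R : realType) d (X : measurableType d)
    (mu : {measure set X -> \bar R}) (f : X -> R[i]) : Prop :=
  measurable_cfun f /\ (\int[mu]_x (normc (f x) ^+ 2)%:E < +oo)%E.

(* Integral against a finite signed measure, through its Jordan decomposition
   (which does not depend on the chosen Hahn decomposition). *)
Definition charge_integral (R : realType) d (Y : measurableType d)
    (nu : {charge set Y -> \bar R}) (f : Y -> R) : R :=
  let P := cid (Hahn_decomposition nu) in
  let N := cid (projT2 P) in
  \int[jordan_pos (projT2 N)]_y f y - \int[jordan_neg (projT2 N)]_y f y.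

Record complex_measure (R : realType) d (Y : measurableType d) := ComplexMeasure {
  cm_re : {charge set Y -> \bar R};
  cm_im : {charge set Y -> \bar R}
}.

Definition cm_val (R : realType) d (Y : measurableType d)
    (om : complex_measure R Y) (E : set Y) : R[i] :=
  fine (cm_re om E) +i* fine (cm_im om E).

Definition cm_integral (R : realType) d (Y : measurableType d)
    (om : complex_measure R Y) (f : Y -> R[i]) : R[i] :=
  (charge_integral (cm_re om) (fun y => complex.Re (f y))
     - charge_integral (cm_im om) (fun y => complex.Im (f y)))
  +i* (charge_integral (cm_re om) (fun y => complex.Im (f y))
     + charge_integral (cm_im om) (fun y => complex.Re (f y))).

(* m = |om| *)
Definition is_total_variation (R : realType) d (Y : measurableType d)
    (om : complex_measure R Y) (m : {measure set Y -> \bar R}) : Prop :=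
  forall A, measurable A -> m A = ereal_sup
    [set s | exists (k : nat) (E : 'I_k -> set Y),
      [/\ forall i, measurable (E i), trivIset setT E,
          \bigcup_i E i = A
        & s = (\sum_(i < k) (normc (cm_val om (E i)))%:E)%E]].

Definition standard_borel (R : realType) d (X : measurableType d) : Prop :=
  exists (P : completePseudoMetricType R) (f : X -> P),
    [/\ hausdorff_space P, @second_countable P, bijective f
      & forall A : set X, measurable A <->
          exists2 B, <<s @open P >> B & A = f @^-1` B].

(* Joint measurability is with respect to the Borel sigma-algebra of G. *)
Definition measurable_action (G : topologicalGroupType) d
    (X : measurableType d) (act : G -> X -> X) : Prop :=
  [/\ forall x, act 1%g x = x,
      forall g h x, act (g * h)%g x = act g (act h x)
    & measurable_fun setT
        (fun p : g_sigma_algebraType (@open G) * X => act p.1 p.2)].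

Definition invariant_measure (R : realType) (G : Type) d (X : measurableType d)
    (act : G -> X -> X) (H : set G) (mu : {measure set X -> \bar R}) : Prop :=
  forall g A, H g -> measurable A -> mu (act g @^-1` A) = mu A.

Definition ergodic_measure (R : realType) (G : Type) d (X : measurableType d)
    (act : G -> X -> X) (H : set G) (nu : {measure set X -> \bar R}) : Prop :=
  forall A, measurable A ->
    (forall g, H g -> nu (A `+` (act g @^-1` A)) = 0%E) ->
    nu A = 0%E \/ nu A = 1%E.

Definition unitary_character (R : realType) m (xi : 'rV[R]_m -> R[i]) : Prop :=
  [/\ continuous (xi : 'rV[R]_m -> (R[i])^o),
      forall v w, xi (v + w) = xi v * xi w
    & forall v, normc (xi v) = 1].

Record discrete_spectrum (R : realType) m (G : Type) d (X : measurableType d)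
    (act : G -> X -> X) (expU : 'rV[R]_m -> G) (nu : {measure set X -> \bar R})
    (Xi : set ('rV[R]_m -> R[i])) (psi : ('rV[R]_m -> R[i]) -> X -> R[i]) :
    Prop := {
  ds_character : forall xi, Xi xi -> unitary_character xi;
  ds_L2 : forall xi, Xi xi -> square_integrable nu (psi xi);
  ds_orthonormal : forall xi eta, Xi xi -> Xi eta ->
    cintegral nu (fun x => psi xi x * (psi eta x)^*) = (xi == eta)%:R;
  ds_total : forall (f : X -> R[i]) (e : R), square_integrable nu f -> 0 < e ->
    exists (s : seq ('rV[R]_m -> R[i])) (c : ('rV[R]_m -> R[i]) -> R[i]),
      (forall xi, xi \in s -> Xi xi) /\
      (\int[nu]_x (normc (f x - \sum_(xi <- s) c xi * psi xi x) ^+ 2)%:E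
         < e%:E)%E;
  ds_eigen : forall xi w, Xi xi ->
    {ae nu, forall x, psi xi (act (expU w) x) = xi w * psi xi x};
  ds_one : Xi (fun=> 1);
  ds_psi_one : {ae nu, forall x, psi (fun=> 1) x = 1}
}.

Definition Wnorm (R : realType) m d (X : measurableType d)
    (nu : {measure set X -> \bar R}) (Xi : set ('rV[R]_m -> R[i]))
    (psi : ('rV[R]_m -> R[i]) -> X -> R[i]) (phi : X -> R[i]) : \bar R :=
  (\esum_(xi in Xi) (normc (cintegral nu (fun x => phi x * (psi xi x)^*)))%:E)%E.

Definition Wspace (R : realType) m d (X : measurableType d)
    (nu : {measure set X -> \bar R}) (Xi : set ('rV[R]_m -> R[i]))
    (psi : ('rV[R]_m -> R[i]) -> X -> R[i]) : set (X -> R[i]) :=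
  [set phi | bounded_measurable phi /\ (Wnorm nu Xi psi phi < +oo)%E].

Record invariant_star_subalgebra (R : realType) (G : Type) d
    (X : measurableType d) (act : G -> X -> X) (A : set (X -> R[i])) : Prop := {
  alg_bounded : A `<=` @bounded_measurable R d X;
  alg_zero : A (fun=> 0);
  alg_add : forall f g, A f -> A g -> A (fun x => f x + g x);
  alg_scale : forall (c : R[i]) f, A f -> A (fun x => c * f x);
  alg_mul : forall f g, A f -> A g -> A (fun x => f x * g x);
  alg_conj : forall f, A f -> A (fun x => (f x)^*);
  alg_act : forall g f, A f -> A (fun x => f (act g x))
}.

(* The family S_1 <= S_2 <= ... is indexed by the positive integers; S 0 is
   irrelevant. *)
Record norm_family (R : realType) (X : Type) (A : set (X -> R[i]))
    (S : nat -> (X -> R[i]) -> R) : Prop := {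
  nf_triangle : forall d f g, (0 < d)%N -> A f -> A g ->
    S d (fun x => f x + g x) <= S d f + S d g;
  nf_scale : forall d (c : R[i]) f, (0 < d)%N -> A f ->
    S d (fun x => c * f x) = normc c * S d f;
  nf_eq0 : forall d f, (0 < d)%N -> A f -> S d f = 0 -> f = (fun=> 0);
  nf_increasing : forall d f, (0 < d)%N -> A f -> S d f <= S d.+1 f;
  nf_conj : forall d f, (0 < d)%N -> A f -> S d (fun x => (f x)^*) = S d f
}.

Definition borel_power (G : topologicalGroupType) (q : nat) :=
  g_sigma_algebraType (@open {ptws 'I_q -> G}).

Definition compactly_supported (R : realType) (G : topologicalGroupType) q
    (m : {measure set (borel_power G q) -> \bar R}) : Prop :=
  exists K : set {ptws 'I_q -> G}, compact K /\ m (~` K) = 0%E.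

Definition translate_prod (R : realType) (G X : Type) (act : G -> X -> X) q
    (phi : 'I_q -> X -> R[i]) (g : 'I_q -> G) (x : X) : R[i] :=
  \prod_(i < q) phi i (act (g i) x).

Definition convolution_stable (R : realType) (G : topologicalGroupType)
    (X : Type) (act : G -> X -> X) (A : set (X -> R[i]))
    (S : nat -> (X -> R[i]) -> R) : Prop :=
  forall (q : nat) (phi : 'I_q -> X -> R[i])
      (om : complex_measure R (borel_power G q))
      (m : {measure set (borel_power G q) -> \bar R}),
    (0 < q)%N -> (forall i, A (phi i)) ->
    is_total_variation om m -> compactly_supported m ->
    let Phi := fun x => cm_integral om (fun g => translate_prod act phi g x) in
    A Phi /\
    forall d, (0 < d)%N ->
      ((S d Phi)%:E <= \int[m]_g (S d (translate_prod act phi g))%:E)%E.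

(* For r = 0, i.e. a single t, the inner minimum is empty and this is rho t. *)
Definition Delta (R : realType) (G : Type) (rho : G -> R) (d : G -> G -> R)
    (r : nat) (t : 'I_r.+1 -> G) : R :=
  \big[Num.min/rho (t ord0)]_(i < r.+1)
    Num.min (rho (t i))
      (\big[Num.min/rho (t i)]_(j < r.+1 | j != i) expR (d (t i) (t j))).

(* Main.v *)
Require Import Defs.
From HB Require Import structures.
From mathcomp Require Import all_boot all_order all_algebra.
From mathcomp Require Import all_classical all_reals all_analysis.
From mathcomp Require Import measurable_realfun complex ring lra.

(** The estimate is proved first with [phi_o] replaced by one element [psi] of the
basis of eigenfunctions, with constants that do not depend on it; it then extends
to [phi_o] because the Fourier coefficients of [phi_o] are absolutely summable and
their sum is its Wiener norm ([fourier_bound]).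

For a fixed eigenfunction the proof is by induction on the number of factors. Let
[Q] stand for the parameter [Delta]. If [Q] is large, two of the [t i] are far
apart. As [T] acts properly and diagonalizably on the Lie algebra of [U], some
weight of this action takes very different values on them ([dist_weights]): by
divisibility of [T], the distance is bounded linearly by the logarithms of the
weights. By pigeonhole, the values of that weight on the family have a gap of a
definite power of [Q] ([gap_split], [weight_gap]), which cuts the family into a
fast and a slow block.

Take an eigenvector [v] for that weight, of suitable length, and translate the
integral by [exp (j v)] for [j < N]. The measure [nu] is invariant and [psi] is
multiplied by a character value. Moving the translation past [t i] stretches it by
the weight of [t i] ([exp_eigen]): the slow factors hardly change, whereas the
factors of the fast block are moved far. Average over [j] and apply the
Cauchy-Schwarz inequality. What remains is the mean square of the centered average
of the translates of the fast block ([variance]). Its diagonal terms contribute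
[O(1/N)]. In an off-diagonal term, the product of two translates of the fast block
is again a product over that block, so the induction hypothesis expresses it by
integrals with respect to [mu], and these nearly factor by mixing (EQ2). The fast
block can therefore be replaced by the product of its means ([core_step]), and the
induction hypothesis handles the slow block. Translating by long vectors increases
the norms [S d] polynomially; the gap is chosen as a small enough power of [Q] for
this growth to be absorbed by the decay of the induction hypothesis
([core_power]).

A single factor is the hypothesis (EQ1) when [psi] is constant. Otherwise it is the
averaging argument with an empty slow block, which gives decay to zero because
[psi] has mean zero ([equidistributed1]). *)

Set Implicit Arguments.
Unset Strict Implicit.
Unset Printing Implicit Defensive.

Import Order.TTheory GRing.Theory Num.Theory.
Import numFieldNormedType.Exports.
Import ComplexField.Normc.

Local Open Scope classical_set_scope.
Local Open Scope ring_scope.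
Local Open Scope complex_scope.
(* In the scope of a product, ^* denotes Num.conj rather than conjc; this fixes the
former reading everywhere. *)
Local Notation "z ^*" := (Num.conj z) : complex_scope.

(** * Complex integrals *)

Section Normc.
Variable R : realType.
Implicit Types z w : R[i].

Lemma normc_ge0 z : 0 <= normc z.
Proof. by case: z => a b; rewrite /= sqrtr_ge0. Qed.

Lemma sqr_normcE z : normc z ^+ 2 = complex.Re z ^+ 2 + complex.Im z ^+ 2.
Proof. by case: z => a b /=; rewrite sqr_sqrtr// addr_ge0 ?sqr_ge0. Qed.

Lemma normc_conj z : normc z^* = normc z.
Proof. by case: z => a b /=; rewrite sqrrN. Qed.

Lemma ler_normcB z w : normc (z - w) <= normc z + normc w.
Proof. by rewrite (le_trans (le_normcD _ _))// normcN. Qed.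

Lemma normc_triangle w z v : normc (z - v) <= normc (z - w) + normc (w - v).
Proof. by rewrite (le_trans _ (le_normcD _ _))// addrA subrK. Qed.

Lemma normc_sum (I : Type) (s : seq I) (P : pred I) (f : I -> R[i]) :
  normc (\sum_(i <- s | P i) f i) <= \sum_(i <- s | P i) normc (f i).
Proof.
elim/big_ind2 : _ => [|x y z t xy zt|//]; first by rewrite normc0.
by rewrite (le_trans (le_normcD _ _))// lerD.
Qed.

Lemma normc_prod (I : Type) (s : seq I) (P : pred I) (f : I -> R[i]) :
  normc (\prod_(i <- s | P i) f i) = \prod_(i <- s | P i) normc (f i).
Proof. by elim/big_ind2 : _ => [|x y z t <- <-|//]; rewrite ?normc1 ?normcM. Qed.

Lemma normc_Re z : `|complex.Re z| <= normc z.
Proof.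
rewrite -(ler_pXn2r (n := 2))// ?nnegrE// ?normc_ge0// sqr_normcE real_normK ?num_real//.
by rewrite lerDl sqr_ge0.
Qed.

Lemma normc_Im z : `|complex.Im z| <= normc z.
Proof.
rewrite -(ler_pXn2r (n := 2))// ?nnegrE// ?normc_ge0// sqr_normcE real_normK ?num_real//.
by rewrite lerDr sqr_ge0.
Qed.

Lemma normc_real (x : R) : normc x%:C = `|x|.
Proof. by rewrite /= expr0n addr0 sqrtr_sqr. Qed.

Lemma normc_nat k : normc (k%:R : R[i]) = k%:R.
Proof. by rewrite normcMn normc1. Qed.

Lemma conjM_normc z : z * z^* = (normc z ^+ 2)%:C.
Proof.
by rewrite sqr_normcE; case: z => a b /=; apply/eqP; rewrite eq_complex /=;
  apply/andP; split; apply/eqP; ring.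
Qed.

Lemma conj_sum (I : Type) (s : seq I) (P : pred I) (f : I -> R[i]) :
  (\sum_(i <- s | P i) f i)^* = \sum_(i <- s | P i) (f i)^*.
Proof. by rewrite rmorph_sum. Qed.

Lemma conj_prod (I : Type) (s : seq I) (P : pred I) (f : I -> R[i]) :
  (\prod_(i <- s | P i) f i)^* = \prod_(i <- s | P i) (f i)^*.
Proof. by rewrite rmorph_prod. Qed.

(** Telescoping: the factors are replaced one at a time. The error [d i] is taken
relative to the bound [F i], so that the product of the bounds factors out. *)
Lemma normc_prodB (I : eqType) (s : seq I) (f g : I -> R[i]) (F d : I -> R) :
  {in s, forall i, normc (f i) <= F i} -> {in s, forall i, normc (g i) <= F i} ->
  {in s, forall i, normc (f i - g i) <= d i * F i} ->
  normc (\prod_(i <- s) f i - \prod_(i <- s) g i) <=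
    (\sum_(i <- s) d i) * \prod_(i <- s) F i.
Proof.
elim: s => [|i s IH] hf hg hd; first by rewrite !big_nil subrr normc0 mul0r.
have sub (Q : I -> Prop) : {in i :: s, forall j, Q j} -> {in s, forall j, Q j}.
  by move=> h j js; apply: h; rewrite inE js orbT.
have F0 : {in i :: s, forall j, 0 <= F j}.
  by move=> j js; apply: le_trans (hf _ js); exact: normc_ge0.
have is_ : i \in i :: s by rewrite inE eqxx.
rewrite !big_cons.
have -> : f i * \prod_(j <- s) f j - g i * \prod_(j <- s) g j =
  (f i - g i) * \prod_(j <- s) f j + g i * (\prod_(j <- s) f j - \prod_(j <- s) g j).
  by ring.
apply: le_trans (le_normcD _ _) _; rewrite !normcM.
have -> : (d i + \sum_(j <- s) d j) * (F i * \prod_(j <- s) F j) =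
  d i * F i * \prod_(j <- s) F j + F i * ((\sum_(j <- s) d j) * \prod_(j <- s) F j).
  by ring.
apply: lerD; apply: ler_pM; rewrite ?normc_ge0//; last 2 first.
- exact: hg.
- by apply: IH; exact: sub.
- exact: hd.
- rewrite normc_prod !big_seq; apply: ler_prod => j js.
  by rewrite normc_ge0/= hf// inE js orbT.
Qed.

End Normc.

Arguments cintegral : simpl never.

(** ** Square-integrable complex functions *)

Section L2.
Context (R : realType) d (X : measurableType d) (P : probability X R).
Implicit Types f g h : X -> R[i].

Local Notation E := (cintegral P).
Local Notation L2 := (square_integrable P).

Definition cintegrable f :=
  P.-integrable setT (EFin \o (fun x => complex.Re (f x))) /\
  P.-integrable setT (EFin \o (fun x => complex.Im (f x))).

Definition nrm2 f : R := \int[P]_x (normc (f x) ^+ 2).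

Lemma measurable_cfunD f g : measurable_cfun f -> measurable_cfun g ->
  measurable_cfun (fun x => f x + g x).
Proof.
move=> [fr fi] [gr gi]; split.
- rewrite (_ : (fun x => _) = (fun x => complex.Re (f x) + complex.Re (g x))).
    exact: measurable_funD.
  by apply/funext => x; case: (f x); case: (g x).
- rewrite (_ : (fun x => _) = (fun x => complex.Im (f x) + complex.Im (g x))).
    exact: measurable_funD.
  by apply/funext => x; case: (f x); case: (g x).
Qed.

Lemma measurable_cfunM f g : measurable_cfun f -> measurable_cfun g ->
  measurable_cfun (fun x => f x * g x).
Proof.
move=> [fr fi] [gr gi]; split.
- rewrite (_ : (fun x => _) = (fun x => complex.Re (f x) * complex.Re (g x)
      - complex.Im (f x) * complex.Im (g x))).
    by apply: measurable_funB; exact: measurable_funM.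
  by apply/funext => x; case: (f x); case: (g x).
- rewrite (_ : (fun x => _) = (fun x => complex.Re (f x) * complex.Im (g x)
      + complex.Im (f x) * complex.Re (g x))).
    by apply: measurable_funD; exact: measurable_funM.
  by apply/funext => x; case: (f x); case: (g x).
Qed.

Lemma measurable_cfun_conj f : measurable_cfun f ->
  measurable_cfun (fun x => (f x)^*).
Proof.
move=> [fr fi]; split.
- by rewrite (_ : (fun x => _) = (fun x => complex.Re (f x)))//;
    apply/funext => x; case: (f x).
- rewrite (_ : (fun x => _) = (fun x => - complex.Im (f x))).
    exact: measurableT_comp.
  by apply/funext => x; case: (f x).
Qed.

Lemma measurable_cfun_cst (z : R[i]) : measurable_cfun (fun _ : X => z).
Proof. by split; exact: measurable_cst. Qed.

Lemma measurable_sqr_normc f : measurable_cfun f ->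
  measurable_fun setT (fun x => normc (f x) ^+ 2).
Proof.
move=> [fr fi].
rewrite (_ : (fun x => _) = (fun x => complex.Re (f x) ^+ 2 + complex.Im (f x) ^+ 2)).
  by apply: measurable_funD; exact: measurable_funX.
by apply/funext => x; rewrite sqr_normcE.
Qed.

Lemma L2_integrable_sqr f : L2 f ->
  P.-integrable setT (EFin \o (fun x => normc (f x) ^+ 2)).
Proof.
move=> [mf fi]; apply/integrableP; split.
  by apply/measurable_EFinP; exact: measurable_sqr_normc.
apply: le_lt_trans fi; apply: ge0_le_integral => //=.
- apply/measurable_EFinP; apply: (measurableT_comp (@normr_measurable R setT)).
  exact: measurable_sqr_normc.
- by apply/measurable_EFinP; exact: measurable_sqr_normc.
- by move=> x _; rewrite lee_fin ger0_norm ?sqr_ge0.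
Qed.

Lemma L2_bounded_by f h (c : R) : measurable_cfun f -> L2 h ->
  (forall x, normc (f x) <= c * normc (h x)) -> L2 f.
Proof.
move=> mf hL le; split=> //.
have /integrableP[_] : P.-integrable setT (EFin \o (fun x => c ^+ 2 * normc (h x) ^+ 2)).
  have := integrableZl measurableT (c ^+ 2) (L2_integrable_sqr hL).
  by apply: eq_integrable => // x _ /=; rewrite EFinM.
apply: le_lt_trans; apply: ge0_le_integral => //=.
- by move=> x _; rewrite lee_fin sqr_ge0.
- by apply/measurable_EFinP; exact: measurable_sqr_normc.
- apply/measurable_EFinP; apply: (measurableT_comp (@normr_measurable R setT)).
  by apply: measurable_funM => //; apply: measurable_sqr_normc; case: hL.
- move=> x _; rewrite lee_fin -exprMn ger0_norm ?sqr_ge0//.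
  by rewrite lerXn2r// nnegrE ?normc_ge0// (le_trans (normc_ge0 (f x))).
Qed.

Lemma L2_cst (z : R[i]) : L2 (fun _ => z).
Proof.
split; first exact: measurable_cfun_cst.
rewrite integral_cst//= -ge0_fin_numE.
  by rewrite fin_numM// fin_num_measure.
by rewrite mule_ge0// lee_fin sqr_ge0.
Qed.

Lemma L2D f g : L2 f -> L2 g -> L2 (fun x => f x + g x).
Proof.
move=> fL gL; split; first by apply: measurable_cfunD; [case: fL|case: gL].
have /integrableP[_] : P.-integrable setT
    (EFin \o (fun x => 2 * normc (f x) ^+ 2 + 2 * normc (g x) ^+ 2)).
  have := integrableD measurableT (integrableZl measurableT 2 (L2_integrable_sqr fL))
     (integrableZl measurableT 2 (L2_integrable_sqr gL)).
  by apply: eq_integrable => // x _ /=; rewrite EFinD !EFinM.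
have mf : measurable_cfun f by case: fL.
have mg : measurable_cfun g by case: gL.
apply: le_lt_trans; apply: ge0_le_integral => //=.
- by move=> x _; rewrite lee_fin sqr_ge0.
- by apply/measurable_EFinP; apply: measurable_sqr_normc; exact: measurable_cfunD.
- apply/measurable_EFinP; apply: (measurableT_comp (@normr_measurable R setT)).
  by apply: measurable_funD; apply: measurable_funM => //; exact: measurable_sqr_normc.
- move=> x _; rewrite lee_fin ger0_norm ?addr_ge0 ?mulr_ge0 ?sqr_ge0 ?normc_ge0//.
  apply: (@le_trans _ _ ((normc (f x) + normc (g x)) ^+ 2)).
    by rewrite lerXn2r// ?nnegrE ?addr_ge0 ?normc_ge0// le_normcD.
  by have := sqr_ge0 (normc (f x) - normc (g x)); lra.
Qed.

Lemma L2_bdd_mul f g (c : R) : L2 f -> measurable_cfun g ->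
  (forall x, normc (g x) <= c) -> L2 (fun x => f x * g x).
Proof.
move=> fL mg gc; apply: (L2_bounded_by (c := c) _ fL).
  by apply: measurable_cfunM => //; case: fL.
by move=> x; rewrite normcM mulrC ler_wpM2r ?normc_ge0.
Qed.

Lemma L2Z (z : R[i]) f : L2 f -> L2 (fun x => z * f x).
Proof.
move=> fL; apply: (L2_bounded_by (c := normc z) _ fL).
  by apply: measurable_cfunM; [exact: measurable_cfun_cst|case: fL].
by move=> x; rewrite normcM.
Qed.

Lemma L2B f g : L2 f -> L2 g -> L2 (fun x => f x - g x).
Proof.
move=> fL gL; rewrite (_ : (fun x => _) = (fun x => f x + -1 * g x)).
  by apply: L2D => //; exact: L2Z.
by apply/funext => x; rewrite mulN1r.
Qed.

Lemma L2_conj f : L2 f -> L2 (fun x => (f x)^*).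
Proof.
move=> fL; apply: (L2_bounded_by (c := 1) _ fL).
  by apply: measurable_cfun_conj; case: fL.
by move=> x; rewrite normc_conj mul1r.
Qed.

Lemma L2_sum (I : eqType) (s : seq I) (F : I -> X -> R[i]) :
  {in s, forall i, L2 (F i)} -> L2 (fun x => \sum_(i <- s) F i x).
Proof.
elim: s => [|i s IH] h.
  rewrite (_ : (fun x => _) = (fun=> 0)); first exact: L2_cst.
  by apply/funext => x; rewrite big_nil.
rewrite (_ : (fun x => _) = (fun x => F i x + \sum_(j <- s) F j x)).
  apply: L2D; first by apply: h; rewrite inE eqxx.
  by apply: IH => j js; apply: h; rewrite inE js orbT.
by apply/funext => x; rewrite big_cons.
Qed.

Lemma L2_bdd f (c : R) : measurable_cfun f -> (forall x, normc (f x) <= c) -> L2 f.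
Proof.
move=> mf fc; apply: (L2_bounded_by (c := c) mf (L2_cst 1)) => x.
by rewrite normc1 mulr1.
Qed.

Lemma L2_cintegrable_mul f g : L2 f -> L2 g -> cintegrable (fun x => f x * g x).
Proof.
move=> fL gL.
have dom : P.-integrable setT (EFin \o (fun x => normc (f x) ^+ 2 + normc (g x) ^+ 2)).
  have := integrableD measurableT (L2_integrable_sqr fL) (L2_integrable_sqr gL).
  by apply: eq_integrable.
have [mr mi] : measurable_cfun (fun x => f x * g x).
  by apply: measurable_cfunM; [case: fL|case: gL].
have le x : normc (f x * g x) <= normc (f x) ^+ 2 + normc (g x) ^+ 2.
  rewrite normcM; have := sqr_ge0 (normc (f x) - normc (g x)).
  have := sqr_ge0 (normc (f x) + normc (g x)); nra.
by split; apply: le_integrable dom => //; try exact/measurable_EFinP;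
  move=> x _ /=; rewrite lee_fin [leRHS]ger0_norm ?addr_ge0 ?sqr_ge0//;
  (apply: le_trans (le x)); [exact: normc_Re|exact: normc_Im].
Qed.

Lemma L2_cintegrable f : L2 f -> cintegrable f.
Proof.
move=> fL; have := L2_cintegrable_mul fL (L2_cst 1).
by under [X in cintegrable X]eq_fun do rewrite mulr1.
Qed.

Lemma cintegralD f g : cintegrable f -> cintegrable g ->
  E (fun x => f x + g x) = E f + E g.
Proof.
move=> [fr fi] [gr gi]; rewrite /cintegral /=; apply/eqP; rewrite eq_complex /=.
by rewrite -!RintegralD//; apply/andP; split; apply/eqP; apply: eq_Rintegral => x _;
  case: (f x); case: (g x).
Qed.

Lemma cintegrableD f g : cintegrable f -> cintegrable g ->
  cintegrable (fun x => f x + g x).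
Proof.
move=> [fr fi] [gr gi]; split.
  have := integrableD measurableT fr gr; apply: eq_integrable => // x _ /=.
  by case: (f x); case: (g x).
have := integrableD measurableT fi gi; apply: eq_integrable => // x _ /=.
by case: (f x); case: (g x).
Qed.

Lemma integrable_EFinZ (k : R) (u : X -> R) : P.-integrable setT (EFin \o u) ->
  P.-integrable setT (EFin \o (fun x => k * u x)).
Proof.
move=> iu; have := integrableZl measurableT k iu.
by apply: eq_integrable => // x _ /=; rewrite EFinM.
Qed.

Lemma cintegralZ (z : R[i]) f : cintegrable f ->
  E (fun x => z * f x) = z * E f.
Proof.
move=> [fr fi]; case: z => a b; rewrite /cintegral /=; apply/eqP; rewrite eq_complex /=.
rewrite -!RintegralZl// -RintegralB//; try exact: integrable_EFinZ.
rewrite -RintegralD//; try exact: integrable_EFinZ.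
by apply/andP; split; apply/eqP; apply: eq_Rintegral => x _; case: (f x).
Qed.

Lemma cintegrableZ (z : R[i]) f : cintegrable f -> cintegrable (fun x => z * f x).
Proof.
move=> [fr fi]; case: z => a b; split.
  have := integrableB measurableT (integrable_EFinZ a fr) (integrable_EFinZ b fi).
  by apply: eq_integrable => // x _ /=; case: (f x).
have := integrableD measurableT (integrable_EFinZ a fi) (integrable_EFinZ b fr).
by apply: eq_integrable => // x _ /=; case: (f x).
Qed.

Lemma cintegral_cst (z : R[i]) : E (fun=> z) = z.
Proof.
have pT : fine (P [set: X]) = 1 by rewrite probability_setT.
by case: z => a b; rewrite /cintegral /= !Rintegral_cst//; rewrite !pT !mulr1.
Qed.

Lemma cintegralB f g : cintegrable f -> cintegrable g ->
  E (fun x => f x - g x) = E f - E g.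
Proof.
move=> fi gi; rewrite -mulN1r -cintegralZ// -cintegralD//; last exact: cintegrableZ.
by congr cintegral; apply/funext => x; rewrite mulN1r.
Qed.

Lemma cintegrableB f g : cintegrable f -> cintegrable g ->
  cintegrable (fun x => f x - g x).
Proof.
move=> fi gi; rewrite (_ : (fun x => _) = (fun x => f x + -1 * g x)).
  by apply: cintegrableD => //; exact: cintegrableZ.
by apply/funext => x; rewrite mulN1r.
Qed.

Lemma cintegral_sum (I : eqType) (s : seq I) (F : I -> X -> R[i]) :
  {in s, forall i, cintegrable (F i)} ->
  E (fun x => \sum_(i <- s) F i x) = \sum_(i <- s) E (F i) /\
  cintegrable (fun x => \sum_(i <- s) F i x).
Proof.
elim: s => [|i s IH] h.
  rewrite big_nil (_ : (fun x => _) = (fun=> 0)).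
    by split; [exact: cintegral_cst|exact/L2_cintegrable/L2_cst].
  by apply/funext => x; rewrite big_nil.
have [|e ci] := IH; first by move=> j js; apply: h; rewrite inE js orbT.
have hi : cintegrable (F i) by apply: h; rewrite inE eqxx.
rewrite (_ : (fun x => _) = (fun x => F i x + \sum_(j <- s) F j x)).
  by rewrite cintegralD// e big_cons; split=> //; exact: cintegrableD.
by apply/funext => x; rewrite big_cons.
Qed.

Lemma cintegral_conj f : cintegrable f -> E (fun x => (f x)^*) = (E f)^*.
Proof.
move=> [fr fi]; rewrite /cintegral /=; apply/eqP; rewrite eq_complex /=.
apply/andP; split; apply/eqP.
  by apply: eq_Rintegral => x _; case: (f x).
rewrite -[RHS]mulN1r -RintegralZl//; apply: eq_Rintegral => x _.
by case: (f x) => a b /=; rewrite mulN1r.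
Qed.

Lemma ae_eq_cintegral f g : measurable_cfun f -> measurable_cfun g ->
  {ae P, forall x, f x = g x} -> E f = E g.
Proof.
move=> [fr fi] [gr gi] fg; rewrite /cintegral /Rintegral; congr (fine _ +i* fine _).
  apply: ae_eq_integral => //; try exact/measurable_EFinP.
  by apply: filterS fg => x -> _.
apply: ae_eq_integral => //; try exact/measurable_EFinP.
by apply: filterS fg => x -> _.
Qed.

Lemma nrm2_ge0 f : 0 <= nrm2 f.
Proof. by apply: Rintegral_ge0 => x _; exact: sqr_ge0. Qed.

Lemma nrm2E f : (nrm2 f)%:C = E (fun x => f x * (f x)^*).
Proof.
rewrite /cintegral /nrm2; apply/eqP; rewrite eq_complex /=; apply/andP; split; apply/eqP.
  by apply: eq_Rintegral => x _; rewrite conjM_normc.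
rewrite (_ : \int[P]_x _ = \int[P]_x (0 : R)); first by rewrite Rintegral_cst// mul0r.
by apply: eq_Rintegral => x _; rewrite conjM_normc.
Qed.

Lemma nrm2_le f (c : R) : measurable_cfun f -> 0 <= c -> (forall x, normc (f x) <= c) ->
  nrm2 f <= c ^+ 2.
Proof.
move=> mf c0 fc; have fL := L2_bdd mf fc.
have pT : fine (P [set: X]) = 1 by rewrite probability_setT.
have -> : c ^+ 2 = \int[P]_x (c ^+ 2).
  by rewrite Rintegral_cst//; rewrite pT mulr1.
apply: le_Rintegral => //; first exact: L2_integrable_sqr.
  by apply: finite_measure_integrable_cst.
by move=> x _; rewrite lerXn2r// ?nnegrE ?normc_ge0.
Qed.

(** The discriminant argument behind the Cauchy-Schwarz inequality, with
[p = |<f, g>|^2] and the quadratic polynomial [nrm2 (f - t <f, g> g)] in [t]. *)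
Lemma quadratic_discr (a p b : R) : 0 <= a -> 0 <= p -> 0 <= b ->
  (forall t, 0 <= a - 2 * t * p + t ^+ 2 * p * b) -> p <= a * b.
Proof.
move=> a0 p0; rewrite le_eqVlt => /predU1P[<-|b0] h.
  rewrite mulr0; case: (ltP 0 p) => // pp.
  have := h ((a + 1) / p); rewrite mulr0 addr0.
  have -> : 2 * ((a + 1) / p) * p = 2 * (a + 1) by field; rewrite gt_eqF.
  lra.
have := h b^-1.
have -> : a - 2 * b^-1 * p + b^-1 ^+ 2 * p * b = a - p / b by field; rewrite gt_eqF.
by rewrite subr_ge0 ler_pdivrMr.
Qed.

Lemma cauchy_schwarzc f g : L2 f -> L2 g ->
  normc (E (fun x => f x * (g x)^*)) ^+ 2 <= nrm2 f * nrm2 g.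
Proof.
move=> fL gL; have [z zE] : exists z, z = E (fun x => f x * (g x)^*) by exists (E (fun x => f x * (g x)^*)).
rewrite -zE.
apply: quadratic_discr; rewrite ?nrm2_ge0 ?sqr_ge0// => t.
have fgi := L2_cintegrable_mul fL (L2_conj gL).
have gfi := L2_cintegrable_mul gL (L2_conj fL).
have ffi := L2_cintegrable_mul fL (L2_conj fL).
have ggi := L2_cintegrable_mul gL (L2_conj gL).
have gfE : E (fun x => g x * (f x)^*) = z^*.
  rewrite zE -cintegral_conj//; congr cintegral; apply/funext => x.
  by rewrite rmorphM /= conjCK mulrC.
set w := t%:C * z.
have : (nrm2 (fun x => f x - w * g x))%:C =
    (nrm2 f - 2 * t * normc z ^+ 2 + t ^+ 2 * normc z ^+ 2 * nrm2 g)%:C.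
  rewrite nrm2E (_ : (fun x => _) = (fun x => (f x * (f x)^* - w^* * (f x * (g x)^*)) -
    (w * (g x * (f x)^*) - w * w^* * (g x * (g x)^*)))); last first.
    by apply/funext => x; rewrite rmorphB rmorphM; ring.
  have i1 := cintegrableB ffi (cintegrableZ w^* fgi).
  have i2 := cintegrableB (cintegrableZ w gfi) (cintegrableZ (w * w^*) ggi).
  rewrite cintegralB//= !cintegralB//; try exact: cintegrableZ.
  rewrite !cintegralZ// gfE -zE -!nrm2E.
  have K : forall u v w' q : R, (u - 2 * v * w' + v ^+ 2 * w' * q)%:C =
      u%:C - v%:C * w'%:C - v%:C * w'%:C + v%:C * v%:C * w'%:C * q%:C.
    by move=> u v w' q; apply/eqP; rewrite eq_complex /=; apply/andP;
      split; apply/eqP; ring.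
  have tc : (t%:C)^* = t%:C by exact: conjc_real.
  rewrite K -conjM_normc /w rmorphM /=.
  by rewrite tc; ring.
case=> <-; exact: nrm2_ge0.
Qed.

(** Cauchy-Schwarz with the bounds on the two norms passed unsquared, which
keeps square roots out of its applications. *)
Lemma normc_cintegralM_le f g (a b : R) : L2 f -> L2 g -> 0 <= a -> 0 <= b ->
  nrm2 f <= a ^+ 2 -> nrm2 g <= b ^+ 2 ->
  normc (E (fun x => f x * g x)) <= a * b.
Proof.
move=> fL gL a0 b0 fa gb.
rewrite -(ler_pXn2r (n := 2))// ?nnegrE ?normc_ge0 ?mulr_ge0//.
have := cauchy_schwarzc fL (L2_conj gL).
rewrite (_ : (fun x => _) = (fun x => f x * g x)); last first.
  by apply/funext => x; rewrite conjCK.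
move=> /le_trans; apply; rewrite exprMn ler_pM ?nrm2_ge0//.
by rewrite /nrm2; under eq_Rintegral do rewrite normc_conj.
Qed.

Lemma normc_cintegral_le f (c : R) : measurable_cfun f -> 0 <= c ->
  (forall x, normc (f x) <= c) -> normc (E f) <= c.
Proof.
move=> mf c0 fc.
have := @normc_cintegralM_le f (fun=> 1) c 1 (L2_bdd mf fc) (L2_cst 1) c0 ler01.
rewrite mulr1 (_ : (fun x => f x * _) = f); last by apply/funext => x; rewrite mulr1.
apply; first exact: nrm2_le.
apply: nrm2_le; [exact: measurable_cfun_cst|exact: ler01|].
by move=> x; rewrite normc1.
Qed.

Lemma nrm2_bdd_mul f g (c : R) : L2 f -> measurable_cfun g ->
  (forall x, normc (g x) <= c) -> nrm2 (fun x => f x * g x) <= nrm2 f * c ^+ 2.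
Proof.
move=> fL mg gc; have fgL := L2_bdd_mul fL mg gc.
rewrite -RintegralZr//; last exact: L2_integrable_sqr.
apply: le_Rintegral => //; first exact: L2_integrable_sqr.
  have := integrable_EFinZ (c ^+ 2) (L2_integrable_sqr fL).
  by apply: eq_integrable => // x _ /=; rewrite mulrC.
move=> x _; rewrite normcM exprMn ler_wpM2l ?sqr_ge0//.
by rewrite lerXn2r// ?nnegrE ?normc_ge0// (le_trans (normc_ge0 (g x))).
Qed.

(** Expanding the square reduces the mean square of a sum to the correlations
of its terms; the off-diagonal ones are small for nearly independent terms. *)
Lemma nrm2_sum_le (J : eqType) (s : seq J) (z : J -> R[i]) (F : J -> X -> R[i]) :
  (forall j, L2 (F j)) ->
  nrm2 (fun x => \sum_(j <- s) z j * F j x) <=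
  \sum_(j <- s) \sum_(k <- s) normc (z j) * normc (z k) *
     normc (E (fun x => F j x * (F k x)^*)).
Proof.
move=> FL.
have ci j k : cintegrable (fun x => F j x * (F k x)^*).
  exact: L2_cintegrable_mul (FL j) (L2_conj (FL k)).
rewrite -[leLHS]ger0_norm ?nrm2_ge0// -normc_real nrm2E.
rewrite (_ : (fun x => _) = (fun x => \sum_(j <- s) \sum_(k <- s)
    z j * (z k)^* * (F j x * (F k x)^*))); last first.
  apply/funext => x; rewrite conj_sum mulr_suml; apply: eq_bigr => j _.
  rewrite mulr_sumr; apply: eq_bigr => k _; rewrite rmorphM /=; ring.
have ci' j k : cintegrable (fun x => z j * (z k)^* * (F j x * (F k x)^*)).
  exact: cintegrableZ.
have inner j := @cintegral_sum _ s _ (fun k _ => ci' j k).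
have [-> _] := @cintegral_sum _ s _ (fun j _ => (inner j).2).
apply: le_trans (normc_sum _ _ _) _; apply: ler_sum => j _.
have [-> _] := inner j.
apply: le_trans (normc_sum _ _ _) _; apply: ler_sum => k _.
by rewrite cintegralZ// !normcM normc_conj.
Qed.

End L2.

(** ** Measure-preserving maps *)

Section MeasurePreserving.
Context (R : realType) d (X : measurableType d) (P : probability X R).
Variable T : X -> X.
Hypothesis mT : measurable_fun setT T.
Hypothesis PT : forall A, measurable A -> P (T @^-1` A) = P A.

Lemma measurable_cfun_comp (f : X -> R[i]) : measurable_cfun f ->
  measurable_cfun (fun x => f (T x)).
Proof.
move=> [fr fi]; split.
  exact: (measurableT_comp fr mT).
exact: (measurableT_comp fi mT).
Qed.

Lemma ge0_integral_preserved (u : X -> R) : measurable_fun setT u ->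
  (forall x, 0 <= u x) ->
  (\int[P]_x (u (T x))%:E = \int[P]_x (u x)%:E)%E.
Proof.
move=> mu u0.
rewrite -[RHS](@eq_measure_integral _ _ _ setT P (pushforward P T)); last first.
  by move=> A mA _; exact: PT.
rewrite ge0_integral_pushforward//; first exact/measurable_EFinP.
by move=> y _; rewrite lee_fin.
Qed.

Lemma L2_preserved (f : X -> R[i]) : square_integrable P f ->
  square_integrable P (fun x => f (T x)).
Proof.
move=> [mf fi]; split; first exact: measurable_cfun_comp.
rewrite (ge0_integral_preserved (u := fun x => normc (f x) ^+ 2))//.
  exact: measurable_sqr_normc.
by move=> x; exact: sqr_ge0.
Qed.

Lemma Rintegral_preserved (u : X -> R) : measurable_fun setT u ->
  P.-integrable setT (EFin \o (u \o T)) ->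
  \int[P]_x u (T x) = \int[P]_x u x.
Proof.
move=> mu iu; rewrite /Rintegral; congr fine.
rewrite -[RHS](@eq_measure_integral _ _ _ setT P (pushforward P T)); last first.
  by move=> A mA _; exact: PT.
rewrite integral_pushforward//; exact/measurable_EFinP.
Qed.

Lemma cintegral_preserved (f : X -> R[i]) : square_integrable P f ->
  cintegral P (fun x => f (T x)) = cintegral P f.
Proof.
move=> fL; have [ir ii] := L2_cintegrable (L2_preserved fL).
case: fL => -[mr mi] _.
by rewrite /cintegral; congr (_ +i* _);
  [apply: (Rintegral_preserved (u := fun x => complex.Re (f x)))|
   apply: (Rintegral_preserved (u := fun x => complex.Im (f x)))].
Qed.

End MeasurePreserving.

(** * Fourier expansions in an orthonormal family *)

Section BestApproximation.
Context (R : realType) d (X : measurableType d) (P : probability X R).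
Context (K : choiceType) (Xi : set K) (psi : K -> X -> R[i])
  (psiL : forall k, Xi k -> square_integrable P (psi k))
  (orth : forall k l, Xi k -> Xi l ->
    cintegral P (fun x => psi k x * (psi l x)^*) = (k == l)%:R).

Definition fourier_coef (f : X -> R[i]) k := cintegral P (fun x => f x * (psi k x)^*).

Definition partial_sum (s : seq K) (c : K -> R[i]) x := \sum_(k <- s) c k * psi k x.

Lemma partial_sum_L2 s c : {in s, forall k, Xi k} -> square_integrable P (partial_sum s c).
Proof. by move=> sX; apply: L2_sum => k /sX kX; apply: L2Z; exact: psiL. Qed.

Lemma cintegral_mul_partial_sum s c f : square_integrable P f -> {in s, forall k, Xi k} ->
  cintegral P (fun x => f x * (partial_sum s c x)^*) =
  \sum_(k <- s) (c k)^* * fourier_coef f k.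
Proof.
move=> fL sX.
rewrite (_ : (fun x => _) = (fun x => \sum_(k <- s) (c k)^* * (f x * (psi k x)^*))); last first.
  apply/funext => x; rewrite conj_sum mulr_sumr; apply: eq_bigr => k _.
  by rewrite rmorphM /=; ring.
have ci k : k \in s -> cintegrable P (fun x => f x * (psi k x)^*).
  by move=> /sX kX; apply: L2_cintegrable_mul => //; apply: L2_conj; exact: psiL.
have [|-> _] := @cintegral_sum _ _ _ P _ s (fun k x => (c k)^* * (f x * (psi k x)^*)).
  by move=> k /ci; exact: cintegrableZ.
by rewrite !big_seq; apply: eq_bigr => k /ci kc; rewrite cintegralZ.
Qed.

Lemma partial_sum_mul s c F (B : R) : measurable_cfun F -> (forall x, normc (F x) <= B) ->
  {in s, forall k, Xi k} ->
  cintegral P (fun x => partial_sum s c x * F x) =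
  \sum_(k <- s) c k * cintegral P (fun x => psi k x * F x).
Proof.
move=> mF FB sX.
rewrite (_ : (fun x => _) = (fun x => \sum_(k <- s) c k * (psi k x * F x))); last first.
  by apply/funext => x; rewrite mulr_suml; apply: eq_bigr => k _; ring.
have ci k : k \in s -> cintegrable P (fun x => psi k x * F x).
  by move=> /sX kX; apply: L2_cintegrable; exact: L2_bdd_mul (psiL kX) mF FB.
have [|-> _] := @cintegral_sum _ _ _ P _ s (fun k x => c k * (psi k x * F x)).
  by move=> k /ci; exact: cintegrableZ.
by rewrite !big_seq; apply: eq_bigr => k /ci kc; rewrite cintegralZ.
Qed.

(** The remainder [h] of the Fourier partial sum is orthogonal to the chosen basis
elements, so [nrm2 h = <h, f - g>] for every combination [g] of them, and
Cauchy-Schwarz concludes. The list may have repetitions, hence [undup]. *)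
Lemma fourier_best (f : X -> R[i]) s c : square_integrable P f -> {in s, forall k, Xi k} ->
  nrm2 P (fun x => f x - partial_sum (undup s) (fourier_coef f) x) <=
  nrm2 P (fun x => f x - partial_sum s c x).
Proof.
move=> fL sX.
have sX' : {in undup s, forall k, Xi k} by move=> k; rewrite mem_undup; exact: sX.
set S := partial_sum (undup s) (fourier_coef f); set g := partial_sum s c.
have SL : square_integrable P S by exact: partial_sum_L2.
have gL : square_integrable P g by exact: partial_sum_L2.
pose h x := f x - S x.
have hL : square_integrable P h by exact: L2B.
have h0 k : k \in s -> fourier_coef h k = 0.
  move=> ks; have kX := sX k ks.
  have pL := L2_conj (psiL kX).
  rewrite /fourier_coef (_ : (fun x => _) =
      (fun x => f x * (psi k x)^* - S x * (psi k x)^*)); last first.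
    by apply/funext => x; rewrite mulrBl.
  rewrite cintegralB; [|exact: L2_cintegrable_mul|exact: L2_cintegrable_mul].
  have -> : cintegral P (fun x => S x * (psi k x)^*) =
      \sum_(l <- undup s) fourier_coef f l * (l == k)%:R.
    rewrite (_ : (fun x => _) = (fun x => \sum_(l <- undup s)
        fourier_coef f l * (psi l x * (psi k x)^*))); last first.
      by apply/funext => x; rewrite mulr_suml; apply: eq_bigr => l _; ring.
    have ci l : l \in undup s -> cintegrable P (fun x => psi l x * (psi k x)^*).
      by move=> /sX' lX; apply: L2_cintegrable_mul => //; exact: psiL.
    have [|-> _] := @cintegral_sum _ _ _ P _ (undup s)
        (fun l x => fourier_coef f l * (psi l x * (psi k x)^*)).
      by move=> l /ci; exact: cintegrableZ.
    rewrite !big_seq; apply: eq_bigr => l ls; rewrite cintegralZ; last exact: ci.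
    by rewrite orth//; exact: sX'.
  rewrite (bigD1_seq k) ?mem_undup ?undup_uniq//= eqxx mulr1 big1 ?addr0 ?subrr//.
  by move=> l /negPf ->; rewrite mulr0.
have hS : cintegral P (fun x => h x * (S x)^*) = 0.
  rewrite cintegral_mul_partial_sum// big_seq big1// => k; rewrite mem_undup => ks.
  by rewrite h0// mulr0.
have hg : cintegral P (fun x => h x * (g x)^*) = 0.
  by rewrite cintegral_mul_partial_sum// big_seq big1// => k ks; rewrite h0// mulr0.
have hh : (nrm2 P h)%:C = cintegral P (fun x => h x * (f x - g x)^*).
  rewrite nrm2E (_ : (fun x => h x * (f x - g x)^*) =
    (fun x => (h x * (h x)^* + h x * (S x)^*) - h x * (g x)^*)); last first.
    by apply/funext => x; rewrite /h !rmorphB /=; ring.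
  have i1 := L2_cintegrable_mul hL (L2_conj hL).
  have i2 := L2_cintegrable_mul hL (L2_conj SL).
  have i3 := L2_cintegrable_mul hL (L2_conj gL).
  rewrite cintegralB//; last exact: cintegrableD.
  by rewrite cintegralD// hS hg addr0 subr0.
have := cauchy_schwarzc hL (L2B fL gL); rewrite -hh normc_real ger0_norm ?nrm2_ge0//.
have := nrm2_ge0 P h; rewrite le_eqVlt => /predU1P[<- _|hp]; first exact: nrm2_ge0.
by rewrite expr2 ler_pM2l.
Qed.

(** A bound valid uniformly over the basis passes to any [f] with absolutely
summable Fourier coefficients: [f] is a Fourier partial sum plus a remainder of
arbitrarily small norm, and the partial sums of the coefficients are at most
their total sum, whatever the cardinality of the basis. *)
Lemma fourier_bound (f F : X -> R[i]) (B eps : R) (z : R[i]) :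
  square_integrable P f -> measurable_cfun F -> (forall x, normc (F x) <= B) -> 0 <= B ->
  (forall e : R, 0 < e -> exists (s : seq K) (c : K -> R[i]), {in s, forall k, Xi k} /\
     nrm2 P (fun x => f x - partial_sum s c x) < e) ->
  (\esum_(k in Xi) (normc (fourier_coef f k))%:E < +oo)%E ->
  0 <= eps ->
  (forall k, Xi k -> normc (cintegral P (fun x => psi k x * F x) - cintegral P (psi k) * z) <= eps) ->
  normc (cintegral P (fun x => f x * F x) - cintegral P f * z) <=
    eps * fine (\esum_(k in Xi) (normc (fourier_coef f k))%:E)%E.
Proof.
move=> fL mF FB B0 tot Wfin eps0 hk; set W := fine _.
pose Z := B + normc z.
have Z0 : 0 <= Z by rewrite addr_ge0 ?normc_ge0.
apply/ler_addgt0Pr => e e0.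
(* The remainder [h] of norm at most [eta] contributes at most [eta * Z]. *)
pose eta := e / (Z + 1).
have eta0 : 0 < eta by rewrite divr_gt0// ltr_wpDl.
have [s [c [sX sc]]] := tot (eta ^+ 2) (exprn_gt0 2 eta0).
have sX' : {in undup s, forall k, Xi k} by move=> k; rewrite mem_undup; exact: sX.
set S := partial_sum (undup s) (fourier_coef f).
have SL : square_integrable P S by exact: partial_sum_L2.
pose h x := f x - S x.
have hL : square_integrable P h by exact: L2B.
have h_le : nrm2 P h <= eta ^+ 2.
  by rewrite (le_trans (fourier_best c fL sX))// ltW.
have sumW : \sum_(k <- undup s) normc (fourier_coef f k) <= W.
  rewrite -lee_fin /W fineK; last first.
    by rewrite ge0_fin_numE//; apply: esum_ge0 => k _; rewrite lee_fin normc_ge0.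
  apply: esum_ge; exists [set` undup s].
    by split; [exact: finite_seq|move=> k /= /sX'].
  by rewrite -sumEFin fsbig_seq// undup_uniq.
have -> : cintegral P (fun x => f x * F x) - cintegral P f * z =
   (cintegral P (fun x => h x * F x) - cintegral P h * z) +
   \sum_(k <- undup s) fourier_coef f k *
      (cintegral P (fun x => psi k x * F x) - cintegral P (psi k) * z).
  have e1 : cintegral P (fun x => f x * F x) =
      cintegral P (fun x => h x * F x) + cintegral P (fun x => S x * F x).
    rewrite -cintegralD; [|exact: L2_cintegrable (L2_bdd_mul hL mF FB)
      |exact: L2_cintegrable (L2_bdd_mul SL mF FB)].
    by congr cintegral; apply/funext => x; rewrite /h -mulrDl subrK.
  have e2 : cintegral P f = cintegral P h + cintegral P (fun x => S x * 1).
    rewrite (_ : (fun x => S x * 1) = S); last by apply/funext => x; rewrite mulr1.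
    rewrite -cintegralD; [|exact: L2_cintegrable|exact: L2_cintegrable].
    by congr cintegral; apply/funext => x; rewrite /h subrK.
  rewrite e1 e2 (partial_sum_mul _ mF FB sX').
  rewrite (partial_sum_mul _ (measurable_cfun_cst _ 1) (B := 1) _ sX'); last first.
    by move=> x; rewrite normc1.
  have e3 k : cintegral P (fun x => psi k x * 1) = cintegral P (psi k).
    by congr cintegral; apply/funext => x; rewrite mulr1.
  rewrite mulrDl opprD addrACA; congr (_ + _).
  rewrite mulr_suml -sumrB; apply: eq_bigr => k _; rewrite e3; ring.
apply: le_trans (le_normcD _ _) _; rewrite addrC; apply: lerD.
  apply: le_trans (normc_sum _ _ _) _.
  apply: (@le_trans _ _ (\sum_(k <- undup s) normc (fourier_coef f k) * eps)).
    rewrite !big_seq; apply: ler_sum => k ks; rewrite normcM ler_wpM2l ?normc_ge0//.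
    by apply: hk; exact: sX'.
  by rewrite -mulr_suml mulrC ler_wpM2l.
apply: (@le_trans _ _ (eta * Z)); last first.
  by rewrite /eta mulrAC ler_pdivrMr ?ltr_wpDl// ler_pM2l// lerDl.
apply: le_trans (ler_normcB _ _) _; rewrite /Z mulrDr; apply: lerD.
  apply: normc_cintegralM_le => //; [exact: L2_bdd FB|exact: ltW|exact: nrm2_le].
rewrite normcM ler_wpM2r ?normc_ge0//.
have -> : h = (fun x => h x * 1) by apply/funext => x; rewrite mulr1.
rewrite -[leRHS]mulr1; apply: normc_cintegralM_le => //; [exact: L2_cst|exact: ltW|].
by apply: nrm2_le; [exact: measurable_cfun_cst|exact: ler01|move=> x; rewrite normc1].
Qed.

End BestApproximation.

(** * The adjoint action *)

Lemma mulgl_continuous (G : topologicalGroupType) (g : G) :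
  continuous (fun x : G => g * x)%g.
Proof.
move=> x; apply: (@continuous_comp _ _ _ (fun x : G => (g, x)) (fun p : G * G => (p.1 * p.2)%g)).
  by apply: cvg_pair => //; exact: cvg_cst.
exact: mulg_continuous.
Qed.

Lemma mulgr_continuous (G : topologicalGroupType) (g : G) :
  continuous (fun x : G => x * g)%g.
Proof.
move=> x; apply: (@continuous_comp _ _ _ (fun x : G => (x, g)) (fun p : G * G => (p.1 * p.2)%g)).
  by apply: cvg_pair => //; exact: cvg_cst.
exact: mulg_continuous.
Qed.

Lemma diag_mx_mulE (R : comPzRingType) m (f g : 'I_m -> R) i :
  (diag_mx (\row_j f j) *m diag_mx (\row_j g j)) i i = f i * g i.
Proof. by rewrite mulmx_diag !mxE eqxx mulr1n. Qed.

Section LieGroup.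
Context (R : realType) (n : nat) (G : topologicalGroupType)
  (atlas : set (chart R n G)) (hG : lie_group atlas)
  (c0 : chart R n G) (hc0 : atlas c0) (hc01 : chart_dom c0 1%g)
  (expG : 'rV[R]_n -> G) (hexp : exponential_map c0 expG).

Local Notation Ad := (Ad c0 expG).

Lemma exp_scaleD (s t : R) v : expG ((s + t) *: v) = (expG (s *: v) * expG (t *: v))%g.
Proof. by have [_] := exp_one_parameter hexp v; apply. Qed.

Lemma exp_scale0 v : expG (0 *: v) = 1%g.
Proof.
have := exp_scaleD 0 0 v; rewrite addr0 => /esym e.
by rewrite -[LHS](mulKg (expG (0 *: v))) e mulVg.
Qed.

Lemma exp0 : expG 0 = 1%g.
Proof. by rewrite -(exp_scale0 0) scale0r. Qed.

(** The curve [t exp(sv) t^-1] is the image of [exp(sv)] under conjugation,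
which is differentiable in the chart at the identity; it is read through a
chart at [t] because left and right translations are separately smooth there. *)
Lemma conj_chart_derivative (t : G) : exists L : {linear 'rV[R]_n -> 'rV[R]_n},
  forall v, is_derive (0 : R) (1 : R)
    (fun s : R => c0 (t * expG (s *: v) * t^-1)%g) (L v).
Proof.
have [ct hct tct] := lie_cover hG t.
have [ci hci tci] := lie_cover hG (t^-1)%g.
have chct := lie_chart hG hct; have chci := lie_chart hG hci.
have chc0 := lie_chart hG hc0.
pose y0 := c0 1%g.
pose F1 (y : 'rV[R]_n) := ct (chart_inv ct (ct t) * chart_inv c0 y)%g.
pose F2 (z : 'rV[R]_n) := c0 (chart_inv ct z * chart_inv ci (ci (t^-1)%g))%g.
have dF1 : differentiable F1 y0.
  have [/(_ (ct t, y0)) dP _] := lie_mul_smooth hG hct hc0 hct 1.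
  have /dP {}dP : [/\ chart_codom ct (ct t, y0).1, chart_codom c0 (ct t, y0).2
      & chart_dom ct (chart_inv ct (ct t, y0).1 * chart_inv c0 (ct t, y0).2)%g].
    by split; [exists t|exists 1%g|rewrite /= !chart_mapK// mulg1].
  apply: (differentiable_comp (f := fun y => (ct t, y)) _ dP).
  by apply: differentiable_pair; [exact: differentiable_cst|exact: ex_diff].
have F1y0 : F1 y0 = ct t by rewrite /F1 !chart_mapK// mulg1.
have dF2 : differentiable F2 (F1 y0).
  rewrite F1y0.
  have [/(_ (ct t, ci (t^-1)%g)) dP _] := lie_mul_smooth hG hct hci hc0 1.
  have /dP {}dP : [/\ chart_codom ct (ct t, ci (t^-1)%g).1,
      chart_codom ci (ct t, ci (t^-1)%g).2
      & chart_dom c0 (chart_inv ct (ct t, ci (t^-1)%g).1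
           * chart_inv ci (ct t, ci (t^-1)%g).2)%g].
    by split; [exists t|exists (t^-1)%g|rewrite /= !chart_mapK// mulgV].
  apply: (differentiable_comp (f := fun z => (z, ci (t^-1)%g)) _ dP).
  by apply: differentiable_pair; [exact: ex_diff|exact: differentiable_cst].
have dF : differentiable (F2 \o F1) y0 by exact: differentiable_comp.
exists ('d (F2 \o F1) y0) => v.
have [hcont _] := exp_one_parameter hexp v.
have e0 : expG ((0 : R) *: v) = 1%g by exact: exp_scale0.
have dh := exp_velocity hexp v.
set h := fun s : R => c0 (expG (s *: v)) in dh.
have h0 : h 0 = y0 by rewrite /h e0.
have dh1 : differentiable h 0 by apply/derivable1_diffP; exact: ex_derive.
apply: (@near_eq_is_derive _ _ _ ((F2 \o F1) \o h)).
  have n1 : \forall s \near (0 : R), chart_dom c0 (expG (s *: v)).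
    apply: (hcont 0); rewrite e0; apply: open_nbhs_nbhs; split=> //.
    exact: chart_open_dom chc0.
  have n2 : \forall s \near (0 : R), chart_dom ct (t * expG (s *: v))%g.
    apply: (continuous_comp (hcont 0) (mulgl_continuous (x := _))).
    rewrite /= e0 mulg1; apply: open_nbhs_nbhs; split=> //.
    exact: chart_open_dom chct.
  near=> s; rewrite /= /F2 /F1 /h !chart_mapK//; by near: s.
have dF' : differentiable (F2 \o F1) (h 0) by rewrite h0.
apply: DeriveDef.
  by apply: diff_derivable; exact: differentiable_comp.
rewrite deriveE; last exact: differentiable_comp.
rewrite (diff_comp dh1 dF').
change ('d (F2 \o F1) (h 0) ('d h 0 1) = 'd (F2 \o F1) y0 v).
by rewrite -(deriveE _ dh1) h0 (@derive_val _ _ _ _ _ _ _ dh).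
Unshelve. all: by end_near. Qed.

Lemma Ad_derive t v : is_derive (0 : R) (1 : R)
  (fun s : R => c0 (t * expG (s *: v) * t^-1)%g) (Ad t v).
Proof.
have [L /(_ v) d] := conj_chart_derivative t.
by split; [exact: ex_derive|rewrite /Defs.Ad derive1E].
Qed.

Lemma Ad_linear t (a : R) u v : Ad t (a *: u + v) = a *: Ad t u + Ad t v.
Proof.
have [L d] := conj_chart_derivative t.
have AdL w : Ad t w = L w.
  by rewrite /Defs.Ad derive1E; exact: (@derive_val _ _ _ _ _ _ _ (d w)).
by rewrite !AdL linearP.
Qed.

Lemma Ad_scale t (a : R) v : Ad t (a *: v) = a *: Ad t v.
Proof.
have A0 : Ad t 0 = 0.
  have := Ad_linear t 1 0 0; rewrite !scale1r addr0 => e.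
  by apply: (addrI (Ad t 0)); rewrite addr0 -e.
by have := Ad_linear t a v 0; rewrite !addr0 A0 addr0.
Qed.

(** Both sides are the values at time 1 of one-parameter subgroups with the same
velocity. *)
Lemma conj_exp t v : (t * expG v * t^-1)%g = expG (Ad t v).
Proof.
have := @exp_unique _ _ _ _ _ hexp (Ad t v) (fun s => t * expG (s *: v) * t^-1)%g.
rewrite scale1r; apply; last exact: Ad_derive.
have [hc hm] := exp_one_parameter hexp v; split.
  move=> s; apply: (@continuous_comp _ _ _ (fun s : R => t * expG (s *: v))%g
    (fun x : G => x * t^-1)%g); last exact: mulgr_continuous.
  apply: (@continuous_comp _ _ _ (fun s : R => expG (s *: v))
    (fun x : G => t * x)%g); last exact: mulgl_continuous.
  exact: hc.
by move=> s r; rewrite hm !mulgA -[(_ * t^-1 * t)%g]mulgA mulVg mulg1.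
Qed.

Lemma conj_exp_scale t v (s : R) : (t * expG (s *: v) * t^-1)%g = expG (s *: Ad t v).
Proof. by rewrite conj_exp Ad_scale. Qed.

Lemma Ad1 v : Ad 1%g v = v.
Proof.
have d := exp_velocity hexp v; rewrite /Defs.Ad derive1E.
rewrite (_ : (fun s : R => _) = (fun s : R => c0 (expG (s *: v)))).
  exact: (@derive_val _ _ _ _ _ _ _ d).
by apply/funext => s; rewrite mul1g invg1 mulg1.
Qed.

Lemma AdM t u v : Ad (t * u)%g v = Ad t (Ad u v).
Proof.
rewrite /Defs.Ad; congr (derive1 _ 0); apply/funext => s; congr (c0 _).
by rewrite -/(Ad u v) -conj_exp_scale invgM !mulgA.
Qed.

Section Subgroup.
Context (U : set G) (m : nat) (uB : 'M[R]_(m, n))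
  (huB : lie_algebra_basis expG U uB) (T : set G) (hT : is_subgroup T)
  (hTU : forall t u, T t -> U u -> U (t * u * t^-1)%g).

Local Notation A := (Ad_mx c0 expG uB).

Lemma subgroupM x y : T x -> T y -> T (x * y)%g.
Proof.
move=> Tx Ty; have [T1 h] := hT; rewrite -[y]invgK; apply: (h) => //.
by rewrite -[(y^-1)%g]mul1g; exact: h.
Qed.

Lemma subgroupV x : T x -> T (x^-1)%g.
Proof. by have [T1 h] := hT; rewrite -[(x^-1)%g]mul1g; exact: h. Qed.

Lemma Ad_stable t v : T t -> (v <= uB)%MS -> (Ad t v <= uB)%MS.
Proof.
have [_ h] := huB => Tt /h Uv; apply/h => s.
by rewrite -conj_exp_scale; apply: hTU.
Qed.

Lemma Ad_mxE t (w : 'rV[R]_m) : T t -> Ad t (w *m uB) = w *m A t *m uB.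
Proof.
move=> Tt.
have AdS (I : Type) (s : seq I) (c : I -> R) (v : I -> 'rV[R]_n) :
    Ad t (\sum_(i <- s) c i *: v i) = \sum_(i <- s) c i *: Ad t (v i).
  elim: s => [|i s IH]; last by rewrite !big_cons Ad_linear IH.
  by rewrite !big_nil -(scale0r 0) Ad_scale !scale0r.
rewrite -mulmxA !mulmx_sum_row AdS; apply: eq_bigr => i _; congr (_ *: _).
rewrite row_mul (_ : row i (A t) = Ad t (row i uB) *m pinvmx uB).
  by rewrite mulmxKpV// Ad_stable// row_sub.
by apply/rowP => j; rewrite !mxE; apply: eq_bigr => k _; rewrite !mxE.
Qed.

Lemma Ad_mx1 : A 1%g = 1%:M.
Proof.
have [uBf _] := huB; have [T1 _] := hT.
apply/row_matrixP => i; apply: (row_free_inj uBf).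
by rewrite [in LHS]rowE -Ad_mxE// Ad1 [in RHS]rowE mulmx1.
Qed.

(** Matrices act on row vectors, hence the exchange of the factors. *)
Lemma Ad_mxM s t : T s -> T t -> A (s * t)%g = A t *m A s.
Proof.
move=> Ts Tt; have [uBf _] := huB.
apply/row_matrixP => i; apply: (row_free_inj uBf); rewrite !rowE.
by rewrite -Ad_mxE; [rewrite AdM !Ad_mxE// mulmxA|exact: subgroupM].
Qed.

(** The eigenvalue of the adjoint action of [t] on the [i]-th row of the
diagonalizing matrix [P]. *)
Definition weight (P : 'M[R]_m) (i : 'I_m) (t : G) : R :=
  (P *m A t *m invmx P) i i.

Section Weights.
Context (P : 'M[R]_m) (hP : P \in unitmx)
  (hdiag : forall t, T t -> is_diag_mx (P *m A t *m invmx P)).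

Lemma weight_diag t : T t -> P *m A t *m invmx P = diag_mx (\row_i weight P i t).
Proof.
move=> Tt; apply/matrixP => i j; rewrite !mxE.
have [<-|ij] := eqVneq i j; first by rewrite mulr1n /weight mxE.
rewrite mulr0n; have /is_diag_mxP/(_ i j) := hdiag Tt; rewrite mxE; exact.
Qed.

Lemma row_eigen t i : T t -> row i P *m A t = weight P i t *: row i P.
Proof.
move=> Tt; rewrite -row_mul -[P *m A t](mulmxKV hP) weight_diag// row_mul row_diag_mx.
by rewrite mxE -scalemxAl -rowE.
Qed.

Lemma weight1 i : weight P i 1%g = 1.
Proof. by rewrite /weight Ad_mx1 mulmx1 mulmxV// mxE eqxx. Qed.

Lemma weightM i s t : T s -> T t -> weight P i (s * t)%g = weight P i s * weight P i t.
Proof.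
move=> Ts Tt.
have -> : weight P i (s * t)%g = ((P *m A t *m invmx P) *m (P *m A s *m invmx P)) i i.
  by rewrite /weight Ad_mxM// !mulmxA mulmxKV.
rewrite mulrC -(diag_mx_mulE (fun j => weight P j t) (fun j => weight P j s)).
by congr ((_ *m _) i i); exact: weight_diag.
Qed.

Lemma weight_neq0 i t : T t -> weight P i t != 0.
Proof.
move=> Tt; apply/eqP => w0.
have := weightM i Tt (subgroupV Tt); rewrite mulgV weight1 w0 mul0r => /eqP.
by rewrite oner_eq0.
Qed.

(** Commuting a translation along an eigenvector past an element of [T] rescales
the translation by the weight. *)
Lemma exp_eigen i t (x : R) : T t ->
  (t * expG ((x *: row i P) *m uB))%g =
  (expG ((x * weight P i t *: row i P) *m uB) * t)%g.
Proof.
move=> Tt; have e : (x *: row i P) *m A t = (x * weight P i t) *: row i P.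
  by rewrite -scalemxAl row_eigen// scalerA.
have := conj_exp t ((x *: row i P) *m uB); rewrite Ad_mxE// e => <-.
by rewrite -mulgA mulVg mulg1.
Qed.

End Weights.
End Subgroup.

End LieGroup.

(** * Distances in T are controlled by the weights *)

Lemma matrix_continuous (R : numFieldType) (V : topologicalType) m n
    (f : V -> 'M[R]_(m, n)) :
  (forall i j, continuous (fun x => f x i j)) -> continuous f.
Proof.
move=> h x A [B hB sBA].
have := @filter_forall V _ (fun (ij : 'I_m * 'I_n) x => B ij.1 ij.2 (f x ij.1 ij.2)) (nbhs x) (nbhs_filter x).
move=> /(_ (fun ij => h ij.1 ij.2 x _ (hB ij.1 ij.2))).
by apply: filterS => y hy; apply: sBA => i j; exact: (hy (i, j)).
Qed.

Lemma continuous_sum (R : numFieldType) (V : topologicalType) (I : Type) (s : seq I)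
    (F : I -> V -> R) :
  (forall i, continuous (F i)) -> continuous (fun x => \sum_(i <- s) F i x).
Proof.
move=> h; elim: s => [|i s IH] x.
  rewrite (_ : (fun x => _) = (fun=> 0)); first exact: cvg_cst.
  by apply/funext => y; rewrite big_nil.
rewrite (_ : (fun x => _) = (fun x => F i x + \sum_(j <- s) F j x)).
  by apply: cvgD; [exact: h|exact: IH].
by apply/funext => y; rewrite big_cons.
Qed.

Lemma conj_diag_compact (R : realType) m (P : 'M[R]_m) (B : set R) : compact B ->
  compact [set invmx P *m diag_mx d *m P | d in [set d : 'rV[R]_m | forall i, B (d ord0 i)]].
Proof.
move=> cB; apply: continuous_compact; last exact: (@rV_compact _ m (fun=> B)).
apply: continuous_subspaceT; apply: matrix_continuous => i j.
have E (d : 'rV[R]_m) : (invmx P *m diag_mx d *m P) i j =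
    \sum_k (invmx P i k * d ord0 k * P k j).
  by rewrite mul_mx_diag mxE; apply: eq_bigr => k _; rewrite !mxE.
under eq_fun do rewrite E; apply: continuous_sum => k d.
exact: (cvgMr_tmp (b := P k j) (cvgMl_tmp (a := invmx P i k)
  (@coord_continuous R 1 m ord0 k d))).
Qed.

Section Properness.
Context (R : realType) (n : nat) (G : topologicalGroupType)
  (atlas : set (chart R n G)) (hG : lie_group atlas)
  (c0 : chart R n G) (hc0 : atlas c0) (hc01 : chart_dom c0 1%g)
  (expG : 'rV[R]_n -> G) (hexp : exponential_map c0 expG)
  (U : set G) (m : nat) (uB : 'M[R]_(m, n))
  (huB : lie_algebra_basis expG U uB) (T : set G) (hT : is_subgroup T)
  (hTU : forall t u, T t -> U u -> U (t * u * t^-1)%g)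
  (hTproper : proper_on T (Ad_mx c0 expG uB))
  (P : 'M[R]_m) (hP : P \in unitmx)
  (hdiag : forall t, T t -> is_diag_mx (P *m Ad_mx c0 expG uB t *m invmx P))
  (k : nat) (tB : 'M[R]_(k, n)) (htB : lie_algebra_basis expG T tB)
  (normT : 'rV[R]_k -> R) (hnormT : is_norm normT)
  (dT : G -> G -> R)
  (hdT : invariant_distance T (fun v => expG (v *m tB)) normT dT).

Local Notation weight := (weight c0 expG uB P).

Lemma dist_refl t : T t -> dT t t = 0.
Proof. by move=> Tt; apply/(dist_eq0 hdT). Qed.

Lemma dist_ge0 s t : T s -> T t -> 0 <= dT s t.
Proof.
move=> Ts Tt; have := dist_triangle hdT Ts Tt Ts.
by rewrite dist_refl// (dist_sym hdT Tt Ts) -mulr2n pmulrn_lge0.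
Qed.

(** The metric induces the topology of [T], so each point has a neighborhood of
radius 1, and compactness leaves finitely many of them. *)
Lemma dist_compact_bounded (K : set G) : compact K -> K `<=` T ->
  exists2 N : nat, (0 < N)%N & forall t, K t -> dT 1%g t <= N%:R.
Proof.
move=> /compact_near_coveringP cK KT; have T1 : T 1%g by case: hT.
have := cK nat \oo (fun N t => T t -> dT 1%g t <= N%:R) _.
case.
  move=> x Kx; have Tx := KT _ Kx.
  have /(dist_topology hdT _ Tx) near1 : exists2 e : R, 0 < e &
      forall s, T s -> dT x s < e -> [set s | dT x s < 1] s by exists 1.
  near=> s N => /= Ts.
  have xs : dT x s < 1 by move: Ts; near: s; exact: near1.
  rewrite (le_trans (dist_triangle hdT T1 Tx Ts))//.
  apply: (@le_trans _ _ (dT 1%g x + 1)); first by rewrite lerD2l ltW.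
  near: N; exact: nbhs_infty_ger.
move=> N _ hN; exists N.+1 => // t Kt.
exact: (hN N.+1 (leqnSn N) t Kt (KT t Kt)).
Unshelve. all: by end_near. Qed.

(** This is where properness of the adjoint action enters: matrices that are
diagonal in the fixed eigenbasis, with entries of absolute value in [[1/e, e]],
form a compact set of invertible matrices. *)
Lemma small_weights_bounded : exists2 N : nat, (0 < N)%N & forall t, T t ->
  (forall i, expR (-1) <= `|weight i t| <= expR 1) -> dT 1%g t <= N%:R.
Proof.
pose B : set R := `[- expR 1, - expR (-1)]%classic `|` `[expR (-1), expR 1]%classic.
have cB : compact B by apply: compactU; exact: segment_compact.
have B0 x : B x -> x != 0.
  have := expR_gt0 (-1 : R); rewrite /B => e0 [] /=; rewrite in_itv/= => /andP[h1 h2].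
    by rewrite lt_eqF// (le_lt_trans h2)// oppr_lt0.
  by rewrite gt_eqF// (lt_le_trans e0).
have cK := conj_diag_compact (P := P) cB.
have [||N N0 hN] := dist_compact_bounded (hTproper cK _).
- move=> _ [d /= dB <-]; rewrite !unitmx_mul unitmx_inv hP andbT /=.
  by rewrite unitmxE det_diag unitfE; apply/prodf_neq0 => i _; exact: B0.
- by move=> t [].
exists N => // t Tt ht; apply: hN; split=> //=.
exists (\row_i weight i t) => /=.
  move=> i; rewrite mxE; have /andP[h1 h2] := ht i.
  case: (lerP 0 (weight i t)) => w0.
    by right; rewrite /= in_itv/=; move: h1 h2; rewrite ger0_norm// => -> ->.
  left; rewrite /= in_itv/=; move: h1 h2; rewrite ltr0_norm//; lra.
rewrite -(weight_diag hdiag)//.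
by rewrite !mulmxA mulVmx// mul1mx mulmxKV.
Qed.

(** The infimum of the empty set is 0, so a point outside the image of the
exponential would be at distance 0 from 1. *)
Lemma exp_surjective t : T t -> exists v, t = expG (v *m tB).
Proof.
move=> Tt; have T1 : T 1%g by case: hT.
apply: contrapT => h.
have d0 : dT 1%g t = 0.
  rewrite (dist_formula hdT)// (_ : [set _ | _ in _] = set0) ?inf0//.
  apply/seteqP; split=> // x [v /= tv _]; apply: h; exists v.
  by rewrite tv mul1g.
have /(dist_eq0 hdT T1 Tt) e := d0.
by apply: h; exists 0; rewrite mul0mx (exp0 hexp).
Qed.

Lemma dist_pow s N : T s -> T (s ^+ N)%g /\ dT 1%g (s ^+ N)%g <= dT 1%g s *+ N.
Proof.
move=> Ts; have T1 : T 1%g by case: hT.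
elim: N => [|N [TN IH]]; first by rewrite expg0 mulr0n dist_refl.
have TS : T (s ^+ N.+1)%g by rewrite expgS; exact: subgroupM.
split=> //; rewrite mulrS (le_trans (dist_triangle hdT T1 Ts TS))// lerD2l.
by rewrite expgS -{1}[s]mulg1 (dist_invariant hdT).
Qed.

(** An [N]-th root of [t] has the logarithms of its weights divided by [N], and
thus lies in the compact set where all weights are of moderate size; by
invariance the distance grows at most linearly along powers. *)
Lemma dist_le_weights : exists2 C : R, 0 < C & forall (t : G) (N : nat), T t -> (0 < N)%N ->
  (forall i, `|ln `|weight i t| | <= N%:R) -> dT 1%g t <= N%:R * C.
Proof.
have [C C0 hC] := small_weights_bounded; exists C%:R; first by rewrite ltr0n.
move=> t N Tt N0 ht; have [v tv] := exp_surjective Tt.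
have [_ hv] := htB.
have Tv (x : R) : T (expG (x *: (v *m tB))).
  by apply: (hv (v *m tB)).1; exact: submxMl.
pose s := expG (N%:R^-1 *: (v *m tB)).
have sN j : (s ^+ j)%g = expG ((j%:R * N%:R^-1) *: (v *m tB)).
  elim: j => [|j IH]; first by rewrite expg0 mul0r (exp_scale0 hexp).
  by rewrite expgS IH -(exp_scaleD hexp) -[j.+1]add1n natrD mulrDl mul1r.
have N0' : (N%:R : R) != 0 by rewrite pnatr_eq0 -lt0n.
have ts : t = (s ^+ N)%g by rewrite sN mulfV// scale1r.
have Ts : T s by exact: Tv.
have wN i j : weight i (s ^+ j)%g = weight i s ^+ j.
  elim: j => [|j IH].
    by rewrite expg0 expr0 (weight1 hG hc0 hc01 hexp huB hT hTU hP).
  rewrite expgS exprS -IH.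
  rewrite (weightM hG hc0 hc01 hexp huB hT hTU hP hdiag)//.
  by have [] := dist_pow j Ts.
have [_ dN] := dist_pow N Ts.
rewrite {1}ts (le_trans dN)// -[dT 1%g s *+ N]mulr_natl ler_wpM2l//.
apply: hC => // i.
have w0 : 0 < `|weight i s|.
  by rewrite normr_gt0; exact: (weight_neq0 hG hc0 hc01 hexp huB hT hTU hP hdiag).
have := ht i; rewrite ts wN normrX lnXn// normrMn -[_ *+ N]mulr_natl.
rewrite -ler_pdivlMl ?ltr0n// mulVf// ler_norml => /andP[h1 h2].
by rewrite -[`|weight i s|]lnK ?posrE// !ler_expR h1.
Qed.

(** Far apart elements of [T] are distinguished by one of the weights, at a
linear rate. When there are no weights this says that [T] is bounded. *)
Lemma dist_weights : exists C kappa : R, [/\ 0 < C, 0 < kappa &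
  forall s t, T s -> T t -> C < dT s t ->
    exists i, kappa * dT s t <= `|ln `|weight i s| - ln `|weight i t| | ].
Proof.
have [C C0 hC] := dist_le_weights.
exists (2 * C), (2 * C)^-1; split; rewrite ?invr_gt0 ?mulr_gt0// => s t Ts Tt dC.
apply: contrapT => /forallNP h.
have Tsi := subgroupV hT Ts.
have Tst : T (s^-1 * t)%g by exact: subgroupM.
have T1 : T 1%g by case: hT.
have dst : dT s t = dT 1%g (s^-1 * t)%g.
  by rewrite -(dist_invariant hdT Ts T1 Tst) mulg1 mulgA mulgV mul1g.
set d := dT s t in dst dC h.
have d0 : 0 < d by rewrite (lt_trans _ dC)// mulr_gt0.
pose N := (Num.truncn ((2 * C)^-1 * d)).+1.
have k0 : 0 <= (2 * C)^-1 * d by rewrite mulr_ge0 ?invr_ge0 ?ltW ?mulr_gt0.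
have N2 := truncnS_gt ((2 * C)^-1 * d).
have N1 : (Num.truncn ((2 * C)^-1 * d))%:R <= (2 * C)^-1 * d by rewrite truncn_le.
have : d <= N%:R * C.
  rewrite dst; apply: hC => // i.
  have w0 u : T u -> 0 < `|weight i u|.
    by move=> Tu; rewrite normr_gt0; exact: (weight_neq0 hG hc0 hc01 hexp huB hT hTU hP hdiag).
  have wt : weight i t = weight i s * weight i (s^-1 * t)%g.
    have := weightM hG hc0 hc01 hexp huB hT hTU hP hdiag i Ts Tst.
    by rewrite mulgA mulgV mul1g.
  have /negP := h i; rewrite -ltNge wt normrM lnM ?posrE ?w0//.
  rewrite opprD addrA subrr add0r normrN => /ltW/le_trans; apply.
  exact: ltW N2.
apply/negP; rewrite -ltNge.
rewrite /N -natr1 mulrDl mul1r.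
apply: (@le_lt_trans _ _ ((2 * C)^-1 * d * C + C)); first by rewrite lerD2r ler_wpM2r// ltW.
have -> : (2 * C)^-1 * d * C = d / 2 by field; rewrite gt_eqF.
lra.
Qed.

End Properness.

(** * A gap among finitely many values *)

Section Gap.
Variables (R : realType) (I : eqType).
Implicit Types (s : seq I) (L : I -> R).

Lemma seq_argmax s L i : i \in s -> exists2 i0, i0 \in s & {in s, forall j, L j <= L i0}.
Proof.
elim: s i => // x s IH i _.
case: s IH => [_|y s IH].
  by exists x; rewrite ?inE// => j; rewrite inE => /eqP ->.
have [|i0 i0s h] := IH y; first by rewrite inE eqxx.
case: (leP (L i0) (L x)) => hx.
  exists x; first by rewrite inE eqxx.
  by move=> j; rewrite inE => /predU1P[->//|/h]; move=> /le_trans; apply.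
exists i0; first by rewrite inE i0s orbT.
by move=> j; rewrite inE => /predU1P[->|/h//]; exact: ltW.
Qed.

(** Pigeonhole: cut the range of [L] below its maximum into consecutive
windows of length [g]; one of the first [size s + 1] windows contains no value. *)
Lemma gap_split s L (g : R) i1 j1 : 0 < g -> i1 \in s -> j1 \in s ->
  (size s).+1%:R * g <= L i1 - L j1 ->
  exists theta, [/\ exists2 i, i \in s & theta <= L i,
    exists2 j, j \in s & L j < theta &
    {in s, forall i, theta <= L i -> L i <= theta + (size s)%:R * g} /\
    {in s, forall i, L i < theta -> L i <= theta - g}].
Proof.
move=> g0 i1s j1s hL.
have [i0 i0s hmax] := seq_argmax L i1s.
pose x i := (L i0 - L i) / g.
have x0 i : i \in s -> 0 <= x i by move=> /hmax h; apply: divr_ge0; [rewrite subr_ge0|exact: ltW].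
pose bucket i := Num.truncn (x i).
have [k ks kN] : exists2 k, (k <= size s)%N & k \notin map bucket s.
  apply: contrapT => h.
  have : {subset iota 0 (size s).+1 <= map bucket s}.
    move=> k; rewrite mem_iota /= add0n ltnS => ks; apply: contrapT => kN.
    by apply: h; exists k => //; apply/negP.
  move=> /(uniq_leq_size (iota_uniq _ _)).
  by rewrite size_iota size_map ltnn.
have cut i : i \in s -> (x i < k%:R) || (k.+1%:R <= x i).
  move=> is_; have : bucket i != k by apply: contra kN => /eqP <-; exact: map_f.
  rewrite neq_ltn => /orP[]; rewrite /bucket.
    by rewrite truncn_lt_nat ?x0// => ->.
  by rewrite truncn_gt_nat => ->; rewrite orbT.
have xE i : L i = L i0 - x i * g by rewrite /x divfK ?gt_eqF// subKr.
(* The maximum lies in the first window, so the empty one is a later one. *)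
have k0 : (0 < k)%N.
  rewrite lt0n; apply: contra kN => /eqP ->; apply/mapP; exists i0 => //.
  by rewrite /bucket /x subrr mul0r truncn0.
have dn (y : R) : (y * g <= k%:R * g) = (y <= k%:R) by rewrite ler_pM2r.
exists (L i0 - k%:R * g); split.
- by exists i0 => //; rewrite gerBl mulr_ge0// (ltW g0).
- exists j1 => //.
  have : k%:R * g < (size s).+1%:R * g by rewrite ltr_pM2r// ltr_nat ltnS.
  by have := hmax _ i1s; lra.
split=> i is_.
  have : k%:R * g <= (size s)%:R * g by rewrite ler_pM2r// ler_nat.
  by have := hmax _ is_; lra.
rewrite (xE i) ltrD2l ltrN2 ltr_pM2r// => kx.
have := cut _ is_; rewrite ltNge (ltW kx) /= -natr1 => h.
have := ler_wpM2r (ltW g0) h; rewrite mulrDl mul1r; lra.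
Qed.

End Gap.

(** * Correlations with one eigenfunction *)

Lemma ge1_powR (R : realType) (x y : R) : 1 <= x -> 0 <= y -> 1 <= x `^ y.
Proof. by move=> x1 y0; have := ler_powR x1 y0; rewrite powRr0. Qed.

Ltac nneg := repeat first [done | assumption | exact: powR_ge0 | exact: sqrtr_ge0
  | exact: ler0n | by apply: ltW | apply: addr_ge0 | apply: exprn_ge0 | apply: mulr_ge0].

Section System.
Context (R : realType) (G : topologicalGroupType)
  (dX : measure_display) (X : measurableType dX) (act : G -> X -> X)
  (mact : forall g, measurable_fun setT (act g))
  (actM : forall g h x, act (g * h)%g x = act g (act h x))
  (mu : probability X R) (hmu : invariant_measure act setT mu)
  (nu : probability X R)
  (m : nat) (e : 'rV[R]_m -> G)
  (eD : forall (x y : R) v, e ((x + y) *: v) = (e (x *: v) * e (y *: v))%g)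
  (hnu : forall w B, measurable B -> nu (act (e w) @^-1` B) = nu B)
  (normu : 'rV[R]_m -> R) (hnormu : is_norm normu)
  (A : set (X -> R[i])) (hA : invariant_star_subalgebra act A)
  (S : nat -> (X -> R[i]) -> R) (hS : norm_family A S)
  (d_o : nat) (hd_o : (0 < d_o)%N)
  (hS1 : forall phi, A phi -> supnorm phi <= S d_o phi)
  (cA a : R) (hcA : 1 <= cA) (ha : 0 < a)
  (hS2 : forall phi w, A phi ->
    supnorm (fun x => phi (act (e w) x) - phi x) <= cA * normu w `^ a * S d_o phi)
  (B b : nat -> R)
  (hB : forall d, (0 < d)%N -> 1 <= B d)
  (hb : forall d, (0 < d)%N -> 0 <= b d)
  (hS3 : forall d phi w, (0 < d)%N -> A phi ->
    S d (fun x => phi (act (e w) x)) <= B d * Num.max 1 (normu w) `^ b d * S d phi)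
  (M : nat -> R) (hM : forall d, (0 < d)%N -> 1 <= M d)
  (hS4 : forall d phi1 phi2, (0 < d)%N -> A phi1 -> A phi2 ->
    S d (fun x => phi1 x * phi2 x) <= M d * S (d + d_o)%N phi1 * S (d + d_o)%N phi2)
  (C c : R) (hC : 1 <= C) (hc : 0 < c)
  (hEQ2 : forall phi1 phi2 w, A phi1 -> A phi2 ->
    normc (cintegral mu (fun x => phi1 (act (e w) x) * phi2 x)
             - cintegral mu phi1 * cintegral mu phi2)
      <= C * Num.max 1 (normu w) `^ (- c) * S d_o phi1 * S d_o phi2).

Lemma S_ge0 d phi : (0 < d)%N -> A phi -> 0 <= S d phi.
Proof.
move=> d0 Ap.
have A0 := alg_scale hA 0 Ap; have AN := alg_scale hA (-1) Ap.
have := nf_triangle hS d0 Ap AN.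
have -> : (fun x => phi x + -1 * phi x) = (fun x => 0 * phi x).
  by apply/funext => x; rewrite mulN1r subrr mul0r.
rewrite !(nf_scale hS)// normc0 mul0r normcN normc1 mul1r.
by rewrite -mulr2n pmulrn_lge0.
Qed.

Lemma S_mono d d' phi : (0 < d)%N -> (d <= d')%N -> A phi -> S d phi <= S d' phi.
Proof.
move=> d0 dd' Ap; rewrite -(subnK dd'); elim: (d' - d)%N => [//|k IH].
rewrite addSn (le_trans IH)// (nf_increasing hS)//.
by rewrite (leq_trans d0)// leq_addl.
Qed.

Lemma bounded_le_supnorm (f : X -> R[i]) x : bounded_measurable f -> normc (f x) <= supnorm f.
Proof.
move=> [_ [K fK]]; apply: sup_upper_bound; last by exists x.
split; first by exists (normc (f x)), x.
by exists K => _ [y _ <-].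
Qed.

Lemma normc_le_S d phi x : (d_o <= d)%N -> A phi -> normc (phi x) <= S d phi.
Proof.
move=> dd Ap; apply: le_trans (S_mono hd_o dd Ap).
by apply: le_trans (hS1 Ap); apply: bounded_le_supnorm; exact: alg_bounded hA _ Ap.
Qed.

Lemma A_measurable phi : A phi -> measurable_cfun phi.
Proof. by move=> /(alg_bounded hA) []. Qed.

Lemma normc_muA d phi : (d_o <= d)%N -> A phi -> normc (cintegral mu phi) <= S d phi.
Proof.
move=> dd Ap; apply: normc_cintegral_le; first exact: A_measurable.
  by apply: S_ge0 => //; exact: leq_trans dd.
by move=> x; exact: normc_le_S.
Qed.

Lemma A_L2 (P : probability X R) phi : A phi -> square_integrable P phi.
Proof.
move=> Ap; apply: (@L2_bdd _ _ _ _ _ (S d_o phi)); first exact: A_measurable.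
by move=> x; exact: normc_le_S.
Qed.

Lemma mu_act g phi : A phi -> cintegral mu (fun x => phi (act g x)) = cintegral mu phi.
Proof.
move=> Ap; apply: cintegral_preserved => //; last exact: A_L2.
by move=> E mE; exact: hmu.
Qed.

Section Products.
Context (I : eqType).
Implicit Types (s : seq I) (t : I -> G) (phi : I -> X -> R[i]).

Definition translates s t phi (x : X) : R[i] := \prod_(i <- s) phi i (act (t i) x).

Lemma translates_measurable s t phi : (forall i, A (phi i)) ->
  measurable_cfun (translates s t phi).
Proof.
move=> Ap; rewrite /translates; elim: s => [|i s IH].
  rewrite (_ : (fun x => _) = (fun=> 1)); first exact: measurable_cfun_cst.
  by apply/funext => x; rewrite big_nil.
rewrite (_ : (fun x => _) =
    (fun x => phi i (act (t i) x) * \prod_(j <- s) phi j (act (t j) x))).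
  apply: measurable_cfunM => //.
  by apply: (measurable_cfun_comp (mact (t i))); exact: A_measurable.
by apply/funext => x; rewrite big_cons.
Qed.

Lemma translates_le s t phi (F : I -> R) x : (forall i y, normc (phi i y) <= F i) ->
  normc (translates s t phi x) <= \prod_(i <- s) F i.
Proof.
move=> h; rewrite /translates normc_prod; apply: ler_prod => i _.
by rewrite normc_ge0 h.
Qed.

Lemma prod_S_ge0 d s phi : (0 < d)%N -> (forall i, A (phi i)) ->
  0 <= \prod_(i <- s) S d (phi i).
Proof. by move=> d0 Ap; apply: prodr_ge0 => i _; exact: S_ge0. Qed.

Lemma prod_S_mono d d' s phi : (0 < d)%N -> (d <= d')%N -> (forall i, A (phi i)) ->
  \prod_(i <- s) S d (phi i) <= \prod_(i <- s) S d' (phi i).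
Proof.
by move=> d0 dd Ap; apply: ler_prod => i _; rewrite S_ge0//= S_mono.
Qed.

Lemma prod_mu_le d s phi : (d_o <= d)%N -> (forall i, A (phi i)) ->
  normc (\prod_(i <- s) cintegral mu (phi i)) <= \prod_(i <- s) S d (phi i).
Proof.
move=> dd Ap; rewrite normc_prod; apply: ler_prod => i _.
by rewrite normc_ge0 normc_muA.
Qed.

End Products.

(** An eigenfunction of the flow [e], normalized in mean square, that is either
the constant 1 or orthogonal to it, as are the members of an orthonormal basis of
eigenfunctions. The condition [0 < m] provides a direction along which a
nontrivial eigenfunction is averaged. *)
Record eigenpair (chi : 'rV[R]_m -> R[i]) (psi : X -> R[i]) : Prop := {
  ep_norm : forall w, normc (chi w) = 1;
  ep_L2 : square_integrable nu psi;
  ep_nrm : nrm2 nu psi <= 1;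
  ep_eigen : forall w, {ae nu, forall x, psi (act (e w) x) = chi w * psi x};
  ep_mean : ((0 < m)%N /\ cintegral nu psi = 0) \/ (psi = (fun=> 1) /\ chi = (fun=> 1))
}.

Lemma eigenpair1 : eigenpair (fun=> 1) (fun=> 1).
Proof.
split=> //.
- by move=> w; exact: normc1.
- exact: L2_cst.
- rewrite -(expr1n R 2); apply: nrm2_le; [exact: measurable_cfun_cst|exact: ler01|].
  by move=> _; rewrite normc1.
- by move=> w; apply: aeW => x; rewrite mulr1.
- by right.
Qed.

(** Invariance of [nu], after moving the translation of [psi] into its
eigenvalue. *)
Lemma eigen_shift chi psi w (F : X -> R[i]) K : eigenpair chi psi ->
  measurable_cfun F -> (forall x, normc (F x) <= K) ->
  cintegral nu (fun x => psi x * F x) =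
    chi w * cintegral nu (fun x => psi x * F (act (e w) x)).
Proof.
move=> ep mF FK; have pL := ep_L2 ep.
have mpsi : measurable_cfun psi by case: pL.
have mFw := measurable_cfun_comp (mact (e w)) mF.
rewrite -(cintegral_preserved (mact (e w)) (hnu w) (L2_bdd_mul pL mF FK)).
rewrite -cintegralZ; last first.
  by apply/L2_cintegrable/(L2_bdd_mul pL mFw) => x; exact: FK.
apply: ae_eq_cintegral.
- apply: measurable_cfunM => //; exact: (measurable_cfun_comp (mact (e w)) mpsi).
- by apply: measurable_cfunM; [exact: measurable_cfun_cst|exact: measurable_cfunM].
- by apply: filterS (ep_eigen ep w) => x ->; rewrite mulrA.
Qed.

(** ** Averaging along an orbit of [e] *)

Section Core.
Context (I : eqType) (s1 s2 : seq I) (t : I -> G) (phi : I -> X -> R[i])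
  (Ap : forall i, A (phi i)) (v : 'rV[R]_m) (w : I -> 'rV[R]_m)
  (tw : forall i (x : R), i \in s1 ++ s2 ->
     (t i * e (x *: v))%g = (e (x *: w i) * t i)%g)
  (N : nat) (N0 : (0 < N)%N) (l L eta : R) (l1 : 1 <= l)
  (ws1 : {in s1, forall i, l <= normu (w i) <= L})
  (ws2 : {in s2, forall i, normu (w i) <= eta}).

(** Translating [x] by [e (j v)] translates the argument of the [i]-th factor by
[e (j (w i))], once [t i] has been moved past. *)
Definition twist (j : nat) (i : I) (x : X) := phi i (act (e (j%:R *: w i)) x).

Lemma A_twist j i : A (twist j i).
Proof. exact: alg_act hA _ _ (Ap i). Qed.

Lemma normu_ge0 u : 0 <= normu u.
Proof.
have [tri sc _] := hnormu; have := tri u (- u).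
rewrite subrr -scaleN1r sc normrN1 mul1r.
by rewrite -[in X in X <= _](scale0r u) sc normr0 mul0r -mulr2n pmulrn_lge0.
Qed.

Lemma normuZ_nat (j : nat) u : normu (j%:R *: u) = j%:R * normu u.
Proof. by have [_ sc _] := hnormu; rewrite sc normr_nat. Qed.

Lemma translates_shift s j x : {subset s <= s1 ++ s2} ->
  translates s t phi (act (e (j%:R *: v)) x) = translates s t (twist j) x.
Proof.
move=> ss; rewrite /translates !big_seq; apply: eq_bigr => i is_.
by rewrite -actM tw ?actM//; exact: ss.
Qed.

Lemma S_twist d K j i : (0 < d)%N -> 1 <= K -> j%:R * normu (w i) <= K ->
  S d (twist j i) <= B d * K `^ b d * S d (phi i).
Proof.
move=> d0 K1 jK; apply: le_trans (hS3 _ d0 (Ap i)) _.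
rewrite ler_wpM2r ?S_ge0// ler_wpM2l ?(le_trans ler01 (hB d0))//.
rewrite normuZ_nat ge0_ler_powR ?hb ?nnegrE ?le_max ?ler01//.
  exact: le_trans ler01 K1.
by rewrite ge_max K1.
Qed.

Section Variance.
Context (d : nat) (d0 : (0 < d)%N) (eps : R) (eps0 : 0 <= eps)
  (Est : forall f : I -> X -> R[i], (forall i, A (f i)) ->
    normc (cintegral nu (translates s1 t f) - \prod_(i <- s1) cintegral mu (f i))
      <= eps * \prod_(i <- s1) S d (f i)).

Let d1 := (d + d_o)%N.
Let F i := S d1 (phi i).
Let K := N%:R * L.
Let gr := M d * (B d1 * K `^ b d1) ^+ 2.
Let p := size s1.
Let mu1 := \prod_(i <- s1) cintegral mu (phi i).
Let PF := \prod_(i <- s1) F i.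

Let dd1 : (d <= d1)%N. Proof. exact: leq_addr. Qed.
Let dod1 : (d_o <= d1)%N. Proof. exact: leq_addl. Qed.
Let d10 : (0 < d1)%N. Proof. exact: leq_trans d0 dd1. Qed.
Let F0 i : 0 <= F i. Proof. exact: S_ge0. Qed.
Let PF0 : 0 <= PF. Proof. by apply: prodr_ge0. Qed.

(** Polynomial growth of the norms along the orbit. *)
Let growth i j : i \in s1 -> (j < N)%N ->
  S d1 (twist j i) <= B d1 * K `^ b d1 * F i.
Proof.
move=> is1 jN; have /andP[h1 h2] := ws1 is1.
have jN' : (j%:R : R) <= N%:R by rewrite ler_nat ltnW.
have N1 : 1 <= (N%:R : R) by rewrite ler1n.
apply: S_twist => //.
  by rewrite -[1]mulr1 ler_pM// (le_trans l1)// (le_trans h1).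
by rewrite ler_pM// normu_ge0.
Qed.

Let gr_ge i : i \in s1 -> 1 <= B d1 * K `^ b d1 /\ B d1 * K `^ b d1 <= gr.
Proof.
move=> is1; have /andP[h1 h2] := ws1 is1.
have N1 : 1 <= (N%:R : R) by rewrite ler1n.
have K1 : 1 <= K by rewrite -[1]mulr1 ler_pM// (le_trans l1)// (le_trans h1).
have h : 1 <= B d1 * K `^ b d1.
  rewrite -[1]mulr1 ler_pM ?hB//.
  by apply: ge1_powR => //; exact: hb.
split=> //; rewrite /gr expr2 mulrA -[leLHS]mul1r ler_pM//.
  exact: le_trans ler01 h.
by rewrite -[1]mulr1 ler_pM// hM.
Qed.

Let prod_gr (f : I -> R) (g : I -> R) : {in s1, forall i, 0 <= f i <= gr * g i} ->
  \prod_(i <- s1) f i <= gr ^+ p * \prod_(i <- s1) g i.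
Proof.
rewrite /p; elim: s1 => [|i s IH] h; first by rewrite !big_nil expr0 mulr1.
rewrite !big_cons exprS mulrACA ler_pM//.
- by have /andP[] := h i (mem_head _ _).
- rewrite big_seq; apply: prodr_ge0 => j js.
  by have /andP[] := h j (mem_behead (s := i :: s) js).
- by have /andP[] := h i (mem_head _ _).
- by apply: IH => j js; exact: h _ (mem_behead (s := i :: s) js).
Qed.

Lemma mean_twist j : (j < N)%N ->
  normc (cintegral nu (translates s1 t (twist j)) - mu1) <= eps * gr ^+ p * PF.
Proof.
move=> jN; have := Est (A_twist j).
have -> : \prod_(i <- s1) cintegral mu (twist j i) = mu1.
  by apply: eq_bigr => i _; exact: mu_act.
move=> /le_trans; apply; rewrite -mulrA ler_wpM2l//; apply: prod_gr => i is1.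
apply/andP; split; first by apply: S_ge0 => //; exact: A_twist.
have [h1 h2] := gr_ge is1.
apply: le_trans (S_mono d0 dd1 (A_twist j i)) _.
by apply: le_trans (growth is1 jN) _; rewrite ler_wpM2r.
Qed.

(** The correlation of two translates of the block [s1] is again the integral of
a block of the same length, to which [Est] applies. *)
Let pair j k i x := twist j i x * (twist k i x)^*.

Let A_pair j k i : A (pair j k i).
Proof. by apply: (alg_mul hA (A_twist j i)); exact: (alg_conj hA (A_twist k i)). Qed.

(** By invariance of [mu], only the difference [j - k] matters; it moves by at
least [l], and mixing applies. *)
Lemma mu_pair j k i : i \in s1 -> j != k ->
  normc (cintegral mu (pair j k i) - cintegral mu (phi i) * (cintegral mu (phi i))^*)
    <= C * l `^ (- c) * F i ^+ 2.
Proof.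
move=> is1 jk; have /andP[h1 h2] := ws1 is1.
have Ac : A (fun x => (phi i x)^*) by exact: alg_conj hA _ (Ap i).
have -> : cintegral mu (pair j k i) = cintegral mu (fun x =>
    phi i (act (e ((j%:R - k%:R) *: w i)) x) * (phi i x)^*).
  rewrite -(mu_act (e (k%:R *: w i)) (phi := fun x =>
    phi i (act (e ((j%:R - k%:R) *: w i)) x) * (phi i x)^*)); last first.
    by apply: (alg_mul hA _ Ac); exact: alg_act hA _ _ (Ap i).
  congr cintegral; apply/funext => x; rewrite /pair /twist.
  by rewrite -actM -eD subrK.
have -> : (cintegral mu (phi i))^* = cintegral mu (fun x => (phi i x)^*).
  by rewrite cintegral_conj//; exact: L2_cintegrable (A_L2 _ (Ap i)).
apply: le_trans (hEQ2 _ (Ap i) Ac) _.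
rewrite (nf_conj hS)// -mulrA -expr2 ler_pM ?sqr_ge0//.
- by rewrite mulr_ge0 ?powR_ge0// (le_trans ler01).
- rewrite ler_wpM2l ?(le_trans ler01)//.
  have l0 : 0 < l by exact: lt_le_trans l1.
  have jk1 : l <= Num.max 1 (normu ((j%:R - k%:R) *: w i)).
    rewrite le_max; apply/orP; right; have [_ sc _] := hnormu; rewrite sc.
    rewrite -[l]mul1r ler_pM// ?(ltW l0)//.
    case: (ltngtP j k) jk => // jk _.
      by rewrite distrC -natrB ?(ltnW jk)// normr_nat ler1n subn_gt0.
    by rewrite -natrB ?(ltnW jk)// normr_nat ler1n subn_gt0.
  rewrite !powRN lef_pV2 ?posrE ?powR_gt0//; last exact: lt_le_trans jk1.
  rewrite ge0_ler_powR ?nnegrE ?(ltW hc) ?(ltW l0)//.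
  exact: le_trans (ltW l0) jk1.
- rewrite lerXn2r// ?nnegrE ?S_ge0//.
  exact: S_mono.
Qed.

Lemma correlation_twist j k : (j < N)%N -> (k < N)%N -> j != k ->
  normc (cintegral nu (fun x => translates s1 t (twist j) x * (translates s1 t (twist k) x)^*)
    - mu1 * mu1^*) <= (eps * gr ^+ p + p%:R * (C * l `^ (- c))) * PF ^+ 2.
Proof.
move=> jN kN jk.
have -> : (fun x => translates s1 t (twist j) x * (translates s1 t (twist k) x)^*) =
    translates s1 t (pair j k).
  by apply/funext => x; rewrite /translates conj_prod -big_split.
have PF2 : PF ^+ 2 = \prod_(i <- s1) F i ^+ 2 by rewrite /PF prodrXl.
apply: le_trans (normc_triangle (\prod_(i <- s1) cintegral mu (pair j k i)) _ _) _.
rewrite mulrDl lerD//.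
  apply: le_trans (Est (A_pair j k)) _.
  rewrite -mulrA ler_wpM2l// PF2; apply: prod_gr => i is1.
  apply/andP; split; first exact: S_ge0.
  apply: le_trans (hS4 d0 (A_twist j i) (alg_conj hA (A_twist k i))) _.
  rewrite [in leLHS](nf_conj hS)//; last exact: A_twist.
  rewrite -/d1 /gr -!mulrA ler_wpM2l ?(le_trans ler01) ?hM//.
  rewrite [leRHS](_ : _ = (B d1 * K `^ b d1 * F i) * (B d1 * K `^ b d1 * F i)); last by ring.
  by rewrite ler_pM ?S_ge0 ?growth//; exact: A_twist.
rewrite /mu1 conj_prod -big_split /= PF2.
have -> : p%:R * (C * l `^ (- c)) = \sum_(i <- s1) C * l `^ (- c).
  by rewrite big_const_seq count_predT iter_addr addr0 mulr_natl.
apply: normc_prodB => i is1.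
- apply: normc_cintegral_le; [exact: A_measurable|exact: sqr_ge0|move=> x].
  rewrite normcM normc_conj expr2 ler_pM ?normc_ge0//.
    exact: normc_le_S dod1 (Ap i).
  exact: normc_le_S dod1 (Ap i).
- by rewrite normcM normc_conj expr2 ler_pM ?normc_ge0 ?normc_muA.
- exact: mu_pair.
Qed.

Let T j := translates s1 t (twist j).

Let T_le j x : normc (T j x) <= PF.
Proof. by apply: translates_le => i y; exact: normc_le_S dod1 (Ap i). Qed.

Let mT j : measurable_cfun (T j).
Proof. by apply: translates_measurable; exact: A_twist. Qed.

Let TL2 j : square_integrable nu (T j).
Proof. exact: L2_bdd (mT j) (T_le j). Qed.

Let mu1_le : normc mu1 <= PF.
Proof. exact: prod_mu_le. Qed.

Let UL2 j : square_integrable nu (fun x => T j x - mu1).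
Proof. exact: L2B (TL2 j) (L2_cst _ _). Qed.

Let U_le j x : normc (T j x - mu1) <= 2 * PF.
Proof. by rewrite (le_trans (ler_normcB _ _))// mulr2n mulrDl mul1r lerD. Qed.

(** Centering is done inside the integral rather than on the factors, since the
algebra need not contain the constants. *)
Lemma centered_correlation j k : (j < N)%N -> (k < N)%N -> j != k ->
  normc (cintegral nu (fun x => (T j x - mu1) * (T k x - mu1)^*)) <=
    (3 * eps * gr ^+ p + p%:R * (C * l `^ (- c))) * PF ^+ 2.
Proof.
move=> jN kN jk.
have -> : cintegral nu (fun x => (T j x - mu1) * (T k x - mu1)^*) =
    (cintegral nu (fun x => T j x * (T k x)^*) - mu1 * mu1^*)
    - (mu1^* * (cintegral nu (T j) - mu1) + mu1 * (cintegral nu (T k) - mu1)^*).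
  rewrite (_ : (fun x => _) = (fun x => (T j x * (T k x)^* - mu1^* * T j x)
      - (mu1 * (T k x)^* - mu1 * mu1^*))); last first.
    by apply/funext => x; rewrite rmorphB /=; ring.
  have i1 := L2_cintegrable_mul (TL2 j) (L2_conj (TL2 k)).
  have i2 := cintegrableZ mu1^* (L2_cintegrable (TL2 j)).
  have i3 := cintegrableZ mu1 (L2_cintegrable (L2_conj (TL2 k))).
  have i4 := L2_cintegrable (L2_cst nu (mu1 * mu1^*)).
  rewrite cintegralB; [|exact: cintegrableB|exact: cintegrableB].
  rewrite !cintegralB// !cintegralZ; try by apply: L2_cintegrable => //; exact: L2_conj.
  rewrite cintegral_conj; last exact: L2_cintegrable.
    by rewrite cintegral_cst rmorphB /=; ring.
  exact: L2_cintegrable (L2_cst _ _).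
apply: le_trans (ler_normcB _ _) _.
have h1 := correlation_twist jN kN jk.
have h2 : normc (mu1^* * (cintegral nu (T j) - mu1)) <= PF * (eps * gr ^+ p * PF).
  by rewrite normcM normc_conj ler_pM ?normc_ge0// mean_twist.
have h3 : normc (mu1 * (cintegral nu (T k) - mu1)^*) <= PF * (eps * gr ^+ p * PF).
  by rewrite normcM normc_conj ler_pM ?normc_ge0// mean_twist.
apply: le_trans (lerD h1 (le_trans (le_normcD _ _) (lerD h2 h3))) _.
by rewrite le_eqVlt; apply/orP; left; apply/eqP; ring.
Qed.

(** The term [4 / N] is the contribution of the diagonal. *)
Lemma variance (z : nat -> R[i]) : (forall j, normc (z j) = 1) ->
  nrm2 nu (fun x => \sum_(j <- iota 0 N) z j / N%:R * (T j x - mu1)) <=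
  PF ^+ 2 * (4 / N%:R + (3 * eps * gr ^+ p + p%:R * (C * l `^ (- c)))).
Proof.
move=> z1; apply: le_trans (nrm2_sum_le _ _ UL2) _.
set q := 3 * eps * gr ^+ p + _.
have q0 : 0 <= q.
  rewrite addr_ge0// ?mulr_ge0 ?powR_ge0 ?exprn_ge0//.
    by rewrite /gr mulr_ge0 ?sqr_ge0// (le_trans ler01)// hM.
  by rewrite (le_trans ler01).
have N0' : (N%:R : R) != 0 by rewrite pnatr_eq0 -lt0n.
apply: (@le_trans _ _ (\sum_(j <- iota 0 N) \sum_(k <- iota 0 N)
    N%:R^-1 ^+ 2 * PF ^+ 2 * (4 * (j == k)%:R + q))).
  rewrite !big_seq; apply: ler_sum => j; rewrite mem_iota /= add0n => jN.
  rewrite !big_seq; apply: ler_sum => k; rewrite mem_iota /= add0n => kN.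
  have zN i : normc (z i / N%:R) = N%:R^-1.
    by rewrite normcM z1 mul1r normcV normc_nat.
  rewrite !zN -expr2 -mulrA ler_wpM2l ?sqr_ge0//.
  have [->|jk] := eqVneq j k; last first.
    by rewrite mulr0 add0r mulrC; exact: centered_correlation.
  apply: (@le_trans _ _ ((2 * PF) ^+ 2)); last first.
    by rewrite mulr1 exprMn -natrX mulrC ler_wpM2l ?sqr_ge0// lerDl.
  apply: normc_cintegral_le; [|exact: sqr_ge0|move=> x].
    apply: measurable_cfunM; last apply: measurable_cfun_conj; by case: (UL2 k).
  by rewrite normcM normc_conj expr2 ler_pM ?normc_ge0.
have E (j : nat) : (j < N)%N -> \sum_(k <- iota 0 N) (4 * (j == k)%:R + q) = 4 + N%:R * q :> R.
  move=> jN; rewrite big_split /= -mulr_sumr (bigD1_seq j) ?mem_iota ?iota_uniq//=.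
  rewrite eqxx big1 ?addr0 ?mulr1; last by move=> k /negPf; rewrite eq_sym => ->.
  by rewrite big_const_seq count_predT iter_addr addr0 size_iota mulr_natl.
rewrite big_seq (eq_bigr (fun=> N%:R^-1 ^+ 2 * PF ^+ 2 * (4 + N%:R * q))); last first.
  by move=> j; rewrite mem_iota /= add0n -mulr_sumr => jN; rewrite E.
rewrite -big_seq big_const_seq count_predT iter_addr addr0 size_iota.
rewrite le_eqVlt; apply/orP; left; apply/eqP; rewrite -mulr_natl; field.
by rewrite N0'.
Qed.

(** The van der Corput step. Translating by [e (j v)] barely changes the slow
factors of [s2], by (S2), multiplies [psi] by a number of modulus 1, and makes
the translates of the fast block [s1] nearly independent. Averaging over [j] thus
replaces that block by the product of its means. *)
Lemma core_step chi psi : eigenpair chi psi ->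
  normc (cintegral nu (fun x => psi x * (translates s1 t phi x * translates s2 t phi x))
    - (\sum_(j <- iota 0 N) chi (j%:R *: v) / N%:R) * mu1
       * cintegral nu (fun x => psi x * translates s2 t phi x))
  <= (Num.sqrt (4 / N%:R + (3 * eps * gr ^+ p + p%:R * (C * l `^ (- c))))
      + (size s2)%:R * (cA * (N%:R * eta) `^ a))
     * (PF * \prod_(i <- s2) F i).
Proof.
move=> ep; have h2 : {subset s2 <= s1 ++ s2} by move=> i; rewrite mem_cat orbC => ->.
set kap := 4 / N%:R + _; set PF2 := \prod_(i <- s2) F i.
have N0' : (N%:R : R) != 0 by rewrite pnatr_eq0 -lt0n.
have PF20 : 0 <= PF2 by apply: prodr_ge0.
pose z j := chi (j%:R *: v).
have z1 j : normc (z j) = 1 by exact: ep_norm ep _.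
pose H := translates s2 t phi; pose Hj j := translates s2 t (twist j).
have mH : measurable_cfun H by exact: translates_measurable.
have mHj j : measurable_cfun (Hj j) by apply: translates_measurable; exact: A_twist.
have H_le x : normc (H x) <= PF2.
  by apply: translates_le => i y; exact: normc_le_S dod1 (Ap i).
have pL := ep_L2 ep.
have mpsi : measurable_cfun psi by case: pL.
pose Y x := \sum_(j <- iota 0 N) z j / N%:R * (T j x - mu1).
have YL : square_integrable nu Y.
  by apply: L2_sum => j _; exact: L2Z.
have pHL : square_integrable nu (fun x => psi x * H x) by exact: L2_bdd_mul H_le.
have sN : \sum_(j <- iota 0 N) (N%:R^-1 : R[i]) = 1.
  rewrite big_const_seq count_predT iter_addr addr0 size_iota -[LHS]mulr_natl mulfV//.
  by rewrite pnatr_eq0 -lt0n.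
have D_le j x : (j < N)%N -> normc (Hj j x - H x) <= (size s2)%:R * (cA * (N%:R * eta) `^ a) * PF2.
  move=> jN.
  have -> : (size s2)%:R * (cA * (N%:R * eta) `^ a) = \sum_(i <- s2) cA * (N%:R * eta) `^ a.
    by rewrite big_const_seq count_predT iter_addr addr0 mulr_natl.
  apply: normc_prodB => i is2.
  - exact: normc_le_S dod1 (Ap i).
  - exact: normc_le_S dod1 (Ap i).
  - have Atw : A (fun x => twist j i x - phi i x).
      have -> : (fun x => twist j i x - phi i x) = (fun x => twist j i x + -1 * phi i x).
        by apply/funext => y; rewrite mulN1r.
      exact: (alg_add hA (A_twist j i) (alg_scale hA _ (Ap i))).
    apply: le_trans (bounded_le_supnorm _ (alg_bounded hA Atw)) _.
    apply: le_trans (hS2 _ (Ap i)) _.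
    have eta0 : 0 <= eta by exact: le_trans (normu_ge0 _) (ws2 is2).
    rewrite ler_pM ?S_ge0 ?mulr_ge0 ?powR_ge0 ?(le_trans ler01 hcA)//; last exact: S_mono.
    rewrite ler_wpM2l ?(le_trans ler01 hcA)// ge0_ler_powR ?nnegrE ?normu_ge0 ?mulr_ge0// ?(ltW ha)//.
    by rewrite normuZ_nat ler_pM ?normu_ge0// ?ws2// ler_nat ltnW.
pose c1 := (size s2)%:R * (cA * (N%:R * eta) `^ a) * PF2.
have main j : cintegral nu (fun x => psi x * (translates s1 t phi x * H x)) =
    z j * cintegral nu (fun x => psi x * (T j x * Hj j x)).
  rewrite (@eigen_shift chi psi (j%:R *: v) _ (PF * PF2) ep).
  - congr (_ * _); congr cintegral; apply/funext => x.
    rewrite (translates_shift j x (s := s1)); last by move=> i; rewrite mem_cat => ->.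
    by rewrite /H (translates_shift j x h2).
  - by apply: measurable_cfunM => //; exact: translates_measurable.
  - move=> x; rewrite normcM ler_pM ?normc_ge0//.
    by apply: translates_le => i y; exact: normc_le_S dod1 (Ap i).
have HjL j : square_integrable nu (fun x => psi x * (T j x * Hj j x)).
  apply: (L2_bdd_mul (c := PF * PF2)) => //; first exact: measurable_cfunM.
  move=> x; rewrite normcM ler_pM ?normc_ge0//.
  by apply: translates_le => i y; exact: normc_le_S dod1 (Ap i).
have HL j : square_integrable nu (fun x => psi x * (T j x * H x)).
  apply: (L2_bdd_mul (c := PF * PF2)) => //; first exact: measurable_cfunM.
  by move=> x; rewrite normcM ler_pM ?normc_ge0.
have split_main : cintegral nu (fun x => psi x * (translates s1 t phi x * H x))
    - (\sum_(j <- iota 0 N) z j / N%:R) * mu1 * cintegral nu (fun x => psi x * H x) =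
    \sum_(j <- iota 0 N) (z j / N%:R) *
      (cintegral nu (fun x => psi x * (T j x * Hj j x)) - cintegral nu (fun x => psi x * (T j x * H x)))
    + cintegral nu (fun x => (psi x * H x) * Y x).
  rewrite (_ : (fun x => psi x * H x * Y x) = (fun x => \sum_(j <- iota 0 N)
     (z j / N%:R * (psi x * (T j x * H x)) - z j / N%:R * mu1 * (psi x * H x)))); last first.
    by apply/funext => x; rewrite /Y mulr_sumr; apply: eq_bigr => j _; ring.
  have ci j : cintegrable nu (fun x => z j / N%:R * (psi x * (T j x * H x))
      - z j / N%:R * mu1 * (psi x * H x)).
    by apply: cintegrableB; apply: cintegrableZ; exact: L2_cintegrable.
  have [-> _] := @cintegral_sum _ _ _ nu _ (iota 0 N) _ (fun j _ => ci j).
  rewrite -big_split /= !mulr_suml.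
  have e1 (u : R[i]) : u = \sum_(j <- iota 0 N) N%:R^-1 * u.
    by rewrite -mulr_suml sN mul1r.
  rewrite [X in X - _]e1 -sumrB; apply: eq_bigr => j _.
  rewrite cintegralB; try by apply: cintegrableZ; exact: L2_cintegrable.
  rewrite !cintegralZ; try exact: L2_cintegrable.
  by rewrite [X in N%:R^-1 * X](main j); ring.
rewrite split_main; apply: le_trans (le_normcD _ _) _.
rewrite [leRHS]mulrDl addrC; apply: lerD.
  rewrite [leRHS](_ : _ = PF2 * (Num.sqrt kap * PF)); last by ring.
  apply: normc_cintegralM_le => //; first by rewrite mulr_ge0 ?sqrtr_ge0.
    apply: le_trans (nrm2_bdd_mul pL mH H_le) _.
    by rewrite -[leRHS]mul1r ler_wpM2r ?sqr_ge0//; exact: ep_nrm ep.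
  rewrite exprMn sqr_sqrtr; first by rewrite mulrC; exact: variance.
  rewrite addr_ge0 ?divr_ge0 ?addr_ge0 ?mulr_ge0 ?powR_ge0 ?exprn_ge0//.
    by rewrite /gr mulr_ge0 ?sqr_ge0// (le_trans ler01)// hM.
  by rewrite (le_trans ler01).
apply: le_trans (normc_sum _ _ _) _.
apply: (@le_trans _ _ (\sum_(j <- iota 0 N) N%:R^-1 * (PF * c1))).
  rewrite !big_seq; apply: ler_sum => j; rewrite mem_iota /= add0n => jN.
  rewrite !normcM z1 mul1r normcV normc_nat ler_wpM2l ?invr_ge0//.
  rewrite -cintegralB; try exact: L2_cintegrable.
  rewrite (_ : (fun x => _) = (fun x => psi x * (T j x * (Hj j x - H x)))); last first.
    by apply/funext => x; ring.
  have mD : measurable_cfun (fun x => T j x * (Hj j x - H x)).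
    apply: measurable_cfunM => //.
    have -> : (fun x => Hj j x - H x) = (fun x => Hj j x + -1 * H x).
      by apply/funext => y; rewrite mulN1r.
    by apply: measurable_cfunD => //; apply: measurable_cfunM => //; exact: measurable_cfun_cst.
  have D_le' x : normc (T j x * (Hj j x - H x)) <= PF * c1.
    by rewrite normcM ler_pM ?normc_ge0// D_le.
  have c10 : 0 <= c1.
    by rewrite !mulr_ge0 ?powR_ge0// (le_trans ler01).
  rewrite -[leRHS]mul1r; apply: normc_cintegralM_le => //.
  - exact: L2_bdd mD D_le'.
  - by rewrite mulr_ge0.
  - by rewrite expr1n; exact: ep_nrm ep.
  - by apply: nrm2_le => //; rewrite mulr_ge0.
rewrite big_const_seq count_predT iter_addr addr0 size_iota -[leLHS]mulr_natl mulrA mulfV//.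
by rewrite mul1r le_eqVlt; apply/orP; left; apply/eqP; rewrite /c1; ring.
Qed.

End Variance.
End Core.

Lemma normc_mean_le chi psi v N : eigenpair chi psi -> (0 < N)%N ->
  normc (\sum_(j <- iota 0 N) chi (j%:R *: v) / N%:R) <= 1.
Proof.
move=> ep N0; apply: le_trans (normc_sum _ _ _) _.
rewrite (eq_bigr (fun=> N%:R^-1)); last first.
  by move=> j _; rewrite normcM (ep_norm ep) mul1r normcV normc_nat.
rewrite big_const_seq count_predT iter_addr addr0 size_iota -[leLHS]mulr_natl mulfV//.
by rewrite pnatr_eq0 -lt0n.
Qed.

(** With all parameters powers of [Q], the error in the averaging step is a
negative power of [Q], as long as the exponent [tau] is small compared with the
rate [delta] available for the block [s1]. *)
Lemma core_power (k d : nat) (D delta tau : R) : (0 < d)%N -> 0 <= D -> 0 < delta -> 0 < tau ->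
  2 * b (d + d_o)%N * k%:R * (tau * (2 + 3 * k%:R)) <= delta / 2 ->
  exists D' delta' : R, [/\ 0 < D', 0 < delta' &
    forall (I : eqType) (s1 s2 : seq I) (t : I -> G) (phi : I -> X -> R[i])
      (v : 'rV[R]_m) (w : I -> 'rV[R]_m) chi psi (Q : R),
    (size s1 <= k)%N -> (size s2 <= k)%N -> (forall i, A (phi i)) -> 1 <= Q ->
    (forall i (x : R), i \in s1 ++ s2 -> (t i * e (x *: v))%g = (e (x *: w i) * t i)%g) ->
    {in s1, forall i, Q `^ tau <= normu (w i) <= Q `^ (tau * (1 + 3 * k%:R))} ->
    {in s2, forall i, normu (w i) <= Q `^ (- (2 * tau))} ->
    (forall f : I -> X -> R[i], (forall i, A (f i)) ->
      normc (cintegral nu (translates s1 t f) - \prod_(i <- s1) cintegral mu (f i))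
      <= D * Q `^ (- delta) * \prod_(i <- s1) S d (f i)) ->
    eigenpair chi psi ->
    exists2 z : R[i], normc z <= 1 /\ (chi = (fun=> 1) -> z = 1) &
    normc (cintegral nu (fun x => psi x * (translates s1 t phi x * translates s2 t phi x))
      - z * (\prod_(i <- s1) cintegral mu (phi i))
       * cintegral nu (fun x => psi x * translates s2 t phi x))
    <= D' * Q `^ (- delta')
      * (\prod_(i <- s1) S (d + d_o)%N (phi i) * \prod_(i <- s2) S (d + d_o)%N (phi i))].
Proof.
move=> d0 D0 delta0 tau0; set d1 := (d + d_o)%N => hgrow.
have d10 : (0 < d1)%N by rewrite addn_gt0 d0.
pose g0 := M d * (B d1 * 2 `^ b d1) ^+ 2.
have B1 := hB d10; have M1 := hM d0; have b0 := hb d10.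
have p2 : 1 <= (2 : R) `^ b d1 by apply: ge1_powR => //; rewrite ler1n.
have Bp1 : 1 <= B d1 * 2 `^ b d1 by apply: mulr_ege1.
have g01 : 1 <= g0.
  by rewrite /g0 expr2; apply: mulr_ege1 => //; exact: mulr_ege1.
have C0 : 0 <= C by exact: le_trans ler01 hC.
have cA0 : 0 <= cA by exact: le_trans ler01 hcA.
have M0 : 0 <= M d by exact: le_trans ler01 M1.
have B0 : 0 <= B d1 by exact: le_trans ler01 B1.
have g00 : 0 <= g0 by exact: le_trans ler01 g01.
pose K0 := 4 + (3 * D * g0 ^+ k + k%:R * C).
have K00 : 0 <= K0.
  by rewrite /K0; nneg.
pose del2 := Num.min tau (Num.min (delta / 2) (c * tau)).
have del20 : 0 < del2 by rewrite !lt_min tau0 divr_gt0// mulr_gt0.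
exists (Num.sqrt K0 + k%:R * (cA * 2 `^ a) + 1), (Num.min (del2 / 2) (tau * a)); split.
- by rewrite ltr_wpDl//; nneg.
- by rewrite lt_min divr_gt0// mulr_gt0.
move=> I s1 s2 t phi v w chi psi Q s1k s2k Ap Q1 tw ws1 ws2 Est ep.
have Q0 : 0 < Q by exact: lt_le_trans Q1.
have Qn0 : Q != 0 by rewrite gt_eqF.
have powM (x y : R) : Q `^ (x + y) = Q `^ x * Q `^ y.
  by rewrite powRD// Qn0 implybT.
have le1pow (x : R) : 0 <= x -> 1 <= Q `^ x by move=> ?; exact: ge1_powR.
have powle (x y : R) : x <= y -> Q `^ x <= Q `^ y by move=> xy; rewrite ler_powR.
(* About [Q `^ tau] translates, consecutive ones [Q `^ tau] apart. *)
pose N := (Num.truncn (Q `^ tau)).+1.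
have N1 : Q `^ tau <= N%:R by rewrite ltW// truncnS_gt.
have Qt1 := le1pow _ (ltW tau0).
have N2 : N%:R <= 2 * Q `^ tau.
  rewrite /N -natr1 mulrDl mul1r lerD//.
  by rewrite truncn_le powR_ge0.
have N0 : (0 < N)%N by [].
exists (\sum_(j <- iota 0 N) chi (j%:R *: v) / N%:R).
  split; first exact: normc_mean_le ep N0.
  move=> ->; rewrite big_const_seq count_predT iter_addr addr0 size_iota mul1r.
  by rewrite -[LHS]mulr_natl mulfV// pnatr_eq0.
have core := @core_step I s1 s2 t phi Ap v w tw N N0 (Q `^ tau)
  (Q `^ (tau * (1 + 3 * k%:R))) (Q `^ (- (2 * tau))) Qt1 ws1 ws2 d d0
  (D * Q `^ (- delta)) (mulr_ge0 D0 (powR_ge0 _ _)) Est chi psi ep.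
apply: le_trans core _; rewrite -/d1.
rewrite ler_wpM2r ?mulr_ge0 ?prod_S_ge0//.
set gr := M d * _.
have grE : gr <= g0 * Q `^ (2 * b d1 * (tau * (2 + 3 * k%:R))).
  rewrite /gr /g0 -mulrA ler_wpM2l//.
  have -> : (2 * b d1 * (tau * (2 + 3 * k%:R))) = (tau * (2 + 3 * k%:R)) * b d1 * 2%:R.
    by ring.
  rewrite [Q `^ (_ * 2%:R)]powRrM powR_mulrn ?powR_ge0// -exprMn lerXn2r// ?nnegrE.
  - by nneg.
  - by nneg.
  rewrite -[leRHS]mulrA ler_wpM2l// [Q `^ (_ * b d1)]powRrM.
  rewrite -(powRM _ (ler0n _ 2) (powR_ge0 _ _)).
  rewrite ge0_ler_powR ?nnegrE ?mulr_ge0 ?powR_ge0//.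
  have -> : tau * (2 + 3 * k%:R) = tau + tau * (1 + 3 * k%:R) by ring.
  by rewrite powM mulrA ler_wpM2r ?powR_ge0.
have gr0 : 0 <= gr by rewrite /gr; nneg.
have k0 : (0 : R) <= k%:R by [].
have ex0 : 0 <= 2 * b d1 * (tau * (2 + 3 * k%:R)).
  by nneg.
have grp : D * Q `^ (- delta) * gr ^+ size s1 <= D * g0 ^+ k * Q `^ (- del2).
  rewrite -!mulrA ler_wpM2l//.
  have h : gr ^+ size s1 <= g0 ^+ k * Q `^ (delta / 2).
    apply: (@le_trans _ _ ((g0 * Q `^ (2 * b d1 * (tau * (2 + 3 * k%:R)))) ^+ size s1)).
      by rewrite lerXn2r ?nnegrE//; nneg.
    apply: (@le_trans _ _ ((g0 * Q `^ (2 * b d1 * (tau * (2 + 3 * k%:R)))) ^+ k)).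
      by apply: ler_weXn2l => //; apply: mulr_ege1 => //; exact: le1pow.
    rewrite exprMn ler_wpM2l ?exprn_ge0//.
    rewrite -powR_mulrn ?powR_ge0// -powRrM; apply: powle.
    by apply: le_trans hgrow; rewrite le_eqVlt; apply/orP; left; apply/eqP; ring.
  apply: le_trans (ler_wpM2l (powR_ge0 _ _) h) _.
  rewrite mulrCA ler_wpM2l ?exprn_ge0// -powM; apply: powle.
  have -> : - delta + delta / 2 = - (delta / 2) by field.
  by rewrite lerN2 !ge_min lexx !orbT.
set kap := 4 / N%:R + _.
have kapE : kap <= K0 * Q `^ (- del2).
  rewrite /kap /K0 [leRHS](_ : _ = 4 * Q `^ (- del2) +
    (3 * (D * g0 ^+ k * Q `^ (- del2)) + k%:R * C * Q `^ (- del2))); last by ring.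
  apply: lerD; [|apply: lerD].
  - rewrite ler_wpM2l// -(powR_inv1 (ler0n _ _)).
    apply: (@le_trans _ _ (Q `^ (- tau))); last by apply: powle; rewrite lerN2 ge_min lexx.
    rewrite powRN powR_inv1// lef_pV2 ?posrE ?powR_gt0//.
  - by rewrite -!(mulrA 3) ler_wpM2l.
  - rewrite -[leRHS]mulrA; apply: ler_pM => //.
      by nneg.
      by rewrite ler_nat.
    rewrite ler_wpM2l// -powRrM; apply: powle.
    by rewrite mulrN lerN2 mulrC !ge_min lexx !orbT.
have sk : Num.sqrt kap <= Num.sqrt K0 * Q `^ (- (del2 / 2)).
  have -> : Q `^ (- (del2 / 2)) = Num.sqrt (Q `^ (- del2)).
    have -> : - del2 = - (del2 / 2) * 2%:R by field.
    by rewrite powRrM powR_mulrn ?powR_ge0// sqrtr_sqr ger0_norm// powR_ge0.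
  by rewrite -sqrtrM// ler_wsqrtr.
rewrite [leRHS]mulrDl mul1r ler_wpDr ?powR_ge0//.
rewrite [leRHS]mulrDl; apply: lerD.
  apply: le_trans sk _; rewrite ler_wpM2l ?sqrtr_ge0//; apply: powle.
  by rewrite lerN2 ge_min lexx.
rewrite -[leRHS]mulrA -[X in _ <= _ * X]mulrA; apply: ler_pM => //.
- by nneg.
- by rewrite ler_nat.
rewrite ler_wpM2l//.
apply: (@le_trans _ _ ((2 * Q `^ (- tau)) `^ a)).
  rewrite ge0_ler_powR ?nnegrE ?(ltW ha)//; try by nneg.
  apply: le_trans (ler_wpM2r (powR_ge0 _ _) N2) _.
  rewrite -mulrA -powM ler_wpM2l//; apply: powle; lra.
rewrite powRM ?powR_ge0// ler_wpM2l ?powR_ge0// -powRrM; apply: powle.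
by rewrite mulNr lerN2 ge_min lexx orbT.
Qed.

Lemma eigenpair_mean_le chi psi : eigenpair chi psi -> normc (cintegral nu psi) <= 1.
Proof.
move=> ep; rewrite -[leRHS]mulr1.
have -> : psi = (fun x => psi x * 1) by apply/funext => x; rewrite mulr1.
apply: normc_cintegralM_le => //; [exact: ep_L2 ep|exact: L2_cst| |].
  by rewrite expr1n; exact: ep_nrm ep.
apply: nrm2_le; [exact: measurable_cfun_cst|exact: ler01|].
by move=> x; rewrite normc1.
Qed.

Lemma trivial_bound (I : eqType) chi psi (s : seq I) t phi d : (d_o <= d)%N ->
  eigenpair chi psi -> (forall i, A (phi i)) ->
  normc (cintegral nu (fun x => psi x * translates s t phi x)
    - cintegral nu psi * \prod_(i <- s) cintegral mu (phi i)) <=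
  2 * \prod_(i <- s) S d (phi i).
Proof.
move=> dd ep Ap; have d0 : (0 < d)%N by exact: leq_trans dd.
have P0 := prod_S_ge0 s d0 Ap.
apply: le_trans (ler_normcB _ _) _; rewrite mulr2n mulrDl mul1r; apply: lerD; last first.
  rewrite normcM -[leRHS]mul1r ler_pM ?normc_ge0//; last exact: prod_mu_le.
  exact: eigenpair_mean_le ep.
have mt := translates_measurable s t Ap.
have tle x : normc (translates s t phi x) <= \prod_(i <- s) S d (phi i).
  by apply: translates_le => i y; exact: normc_le_S.
rewrite -[leRHS]mul1r; apply: normc_cintegralM_le => //.
- exact: ep_L2 ep.
- exact: L2_bdd tle.
- by rewrite expr1n; exact: ep_nrm ep.
- exact: nrm2_le.
Qed.

(** ** Induction on the number of factors *)

Section Induction.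
Context (T Tplus : set G) (hTplus : Tplus `<=` T)
  (D_o delta_o : R) (hD_o : 1 <= D_o) (hdelta_o : 0 < delta_o)
  (rho : G -> R) (dT : G -> G -> R)
  (hEQ1 : forall phi t, A phi -> Tplus t ->
    normc (cintegral nu (fun x => phi (act t x)) - cintegral mu phi)
      <= D_o * rho t `^ (- delta_o) * S d_o phi)
  (wt : 'I_m -> G -> R) (r : 'I_m -> 'rV[R]_m) (r0 : forall i, r i != 0)
  (wt0 : forall i t, T t -> wt i t != 0)
  (wtE : forall i t (x : R), T t ->
     (t * e (x *: r i))%g = (e ((x * wt i t) *: r i) * t)%g)
  (C0 kappa : R) (hC0 : 0 < C0) (hkappa : 0 < kappa)
  (hwt : forall s t, T s -> T t -> C0 < dT s t ->
     exists i, kappa * dT s t <= `|ln `|wt i s| - ln `|wt i t| |).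

Definition dispersed (I : eqType) (Q : R) (s : seq I) (t : I -> G) :=
  {in s, forall i, Tplus (t i) /\ Q <= rho (t i)} /\
  {in s &, forall i j, i != j -> Q <= expR (dT (t i) (t j))}.

(** The constants do not depend on the eigenpair: this uniformity is what the
summation over the spectrum needs. *)
Definition equidistributed (k d : nat) (D delta : R) :=
  forall (I : eqType) chi psi (s : seq I) t phi (Q : R),
    eigenpair chi psi -> uniq s -> (size s <= k)%N -> 1 <= Q -> dispersed Q s t ->
    (forall i, A (phi i)) ->
    normc (cintegral nu (fun x => psi x * translates s t phi x)
      - cintegral nu psi * \prod_(i <- s) cintegral mu (phi i))
    <= D * Q `^ (- delta) * \prod_(i <- s) S d (phi i).

Lemma bound_weaken (D D' delta delta' Q : R) : 0 <= D -> D <= D' -> delta' <= delta -> 1 <= Q ->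
  D * Q `^ (- delta) <= D' * Q `^ (- delta').
Proof. by move=> *; rewrite ler_pM ?powR_ge0// ler_powR// lerN2. Qed.

Lemma small_exponent (u1 u2 x1 x2 : R) : 0 <= u1 -> 0 <= u2 -> 0 < x1 -> 0 < x2 ->
  exists2 tau : R, 0 < tau & u1 * tau <= x1 /\ u2 * tau <= x2.
Proof.
move=> u10 u20 x10 x20.
have p1 : 0 < u1 + 1 by lra.
have p2 : 0 < u2 + 1 by lra.
exists (Num.min (x1 / (u1 + 1)) (x2 / (u2 + 1))).
  by rewrite lt_min !divr_gt0.
have key (u x y : R) : 0 <= u -> 0 < x -> y <= x / (u + 1) -> u * y <= x.
  move=> u0 x0 h; have q : 0 < u + 1 by lra.
  apply: (@le_trans _ _ (u * (x / (u + 1)))); first by rewrite ler_wpM2l.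
  by rewrite mulrA ler_pdivrMr// mulrDr mulr1 mulrC lerDl ltW.
by split; apply: key => //; rewrite ge_min lexx ?orbT.
Qed.

(** The vector is normalized so that an element of weight [exp theta] stretches
it to length exactly [Q `^ tau]. *)
Lemma normalized_vector (i0 : 'I_m) (I : eqType) (s : seq I) t (theta Q tau : R) :
  {in s, forall i, T (t i)} -> 0 < Q ->
  exists (v : 'rV[R]_m) (w : I -> 'rV[R]_m),
    (forall i (x : R), i \in s -> (t i * e (x *: v))%g = (e (x *: w i) * t i)%g) /\
    {in s, forall i, normu (w i) = Q `^ tau * expR (ln `|wt i0 (t i)| - theta)}.
Proof.
move=> Ts Q0; have nr : 0 < normu (r i0).
  rewrite lt_neqAle normu_ge0 andbT eq_sym; apply: contra (r0 i0) => /eqP h.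
  by have [_ _ h0] := hnormu; apply/eqP; exact: h0.
pose h := Q `^ tau * expR (- theta) / normu (r i0).
exists (h *: r i0), (fun i => (h * wt i0 (t i)) *: r i0); split.
  by move=> i x is_; rewrite !scalerA wtE ?mulrA//; exact: Ts.
move=> i is_; have [_ sc _] := hnormu; rewrite sc normrM /h.
have w0 : 0 < `|wt i0 (t i)| by rewrite normr_gt0 wt0//; exact: Ts.
rewrite ger0_norm; last by rewrite divr_ge0 ?mulr_ge0 ?powR_ge0 ?expR_ge0 ?(ltW nr).
rewrite expRD lnK ?posrE//; field.
by rewrite gt_eqF.
Qed.

(** For the constant eigenfunction this is (EQ1). For the others the mean is zero,
and the averaging step applies with the single factor as fast block, no slow
block, and (EQ1) as the estimate for the fast block. *)
Lemma equidistributed1 : exists d D delta,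
  [/\ (d_o <= d)%N, 0 < D, 0 < delta & equidistributed 1 d D delta].
Proof.
have b0 := @hb (d_o + d_o)%N (ltn_addl _ hd_o).
have x1 : 0 <= 2 * b (d_o + d_o)%N * 1%:R * (2 + 3 * 1%:R) by nneg.
have d2 : 0 < delta_o / 2 by rewrite divr_gt0.
have [tau tau0 [h1 _]] := small_exponent x1 (lexx 0) d2 ltr01.
have Do0 : 0 <= D_o by exact: le_trans hD_o.
have h2 : 2 * b (d_o + d_o)%N * 1%:R * (tau * (2 + 3 * 1%:R)) <= delta_o / 2.
  by apply: le_trans h1; rewrite le_eqVlt; apply/orP; left; apply/eqP; ring.
have [D' [del' [D'0 del'0 core]]] := core_power hd_o Do0 hdelta_o tau0 h2.
exists (d_o + d_o)%N, (D' + D_o), (Num.min del' delta_o); split.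
- exact: leq_addl.
- by rewrite ltr_pwDl.
- by rewrite lt_min del'0.
move=> I chi psi s t phi Q ep us ss Q1 [sep _] Ap.
have Q0 : 0 < Q by exact: lt_le_trans Q1.
have P0 := prod_S_ge0 s (ltn_addl d_o hd_o) Ap.
case: s us ss sep P0 => [_ _ _ P0|i [|//] _ _ sep P0].
  rewrite /translates !big_nil !mulr1.
  rewrite (_ : (fun x => _) = psi) ?subrr ?normc0; last first.
    by apply/funext => x; rewrite big_nil mulr1.
  by rewrite mulr_ge0 ?powR_ge0// addr_ge0// ltW.
have [Tti Qr] := sep i (mem_head _ _).
have eq1 (f : I -> X -> R[i]) : (forall i, A (f i)) ->
    normc (cintegral nu (translates [:: i] t f) - \prod_(j <- [:: i]) cintegral mu (f j))
      <= D_o * Q `^ (- delta_o) * \prod_(j <- [:: i]) S d_o (f j).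
  move=> Af; rewrite !big_seq1.
  rewrite (_ : translates _ _ _ = (fun x => f i (act (t i) x))); last first.
    by apply/funext => x; rewrite /translates big_seq1.
  apply: le_trans (hEQ1 (Af i) Tti) _; rewrite ler_wpM2r ?S_ge0// ler_wpM2l//.
  rewrite !powRN lef_pV2 ?posrE ?powR_gt0//; last exact: lt_le_trans Qr.
  by rewrite ge0_ler_powR ?nnegrE ?(ltW hdelta_o) ?(ltW Q0)// (le_trans (ltW Q0)).
case: (ep_mean ep) => [[m0 mean0]|[-> _]]; last first.
  rewrite (_ : (fun x => 1 * _) = translates [:: i] t phi); last first.
    by apply/funext => x; rewrite mul1r.
  rewrite cintegral_cst mul1r.
  apply: le_trans (eq1 _ Ap) _.
  apply: ler_pM => //; rewrite ?mulr_ge0 ?powR_ge0 ?prod_S_ge0//.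
    by apply: bound_weaken => //; [rewrite lerDr ltW|rewrite ge_min lexx orbT].
  by apply: prod_S_mono => //; exact: leq_addr.
rewrite mean0 mul0r subr0.
have Ts : {in [:: i], forall j, T (t j)}.
  by move=> j; rewrite inE => /eqP ->; exact: hTplus.
have [v [w [tw nw]]] := normalized_vector (Ordinal m0)
  (ln `|wt (Ordinal m0) (t i)|) tau Ts Q0.
have tw' j (x : R) : j \in [:: i] ++ [::] -> (t j * e (x *: v))%g = (e (x *: w j) * t j)%g.
  by rewrite cats0; exact: tw.
have nw' : {in [:: i], forall j, Q `^ tau <= normu (w j) <= Q `^ (tau * (1 + 3 * 1%:R))}.
  move=> j js; rewrite (nw _ js); move: js; rewrite inE => /eqP ->.
  by rewrite subrr expR0 mulr1 lexx ler_powR// ler_peMr ?(ltW tau0)//; lra.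
have n0 : {in [::], forall j : I, normu (w j) <= Q `^ (- (2 * tau))} by [].
have [z _ hz] := core I [:: i] [::] t phi v w chi psi Q isT isT Ap Q1 tw' nw' n0 eq1 ep.
rewrite /translates big_nil in hz.
apply: le_trans (le_trans _ hz) _.
  rewrite le_eqVlt; apply/orP; left; apply/eqP; congr normc.
  rewrite [X in _ * X](_ : _ = 0); last first.
    rewrite -[RHS]mean0; congr cintegral; apply/funext => x.
    by rewrite big_nil mulr1.
  rewrite mulr0 subr0; congr cintegral; apply/funext => x.
  by rewrite big_nil mulr1.
rewrite mulr1 ler_wpM2r// bound_weaken//.
- exact: ltW.
- by rewrite lerDl.
- by rewrite ge_min lexx.
Qed.

(** Two elements of a dispersed family are distinguished by some weight, at scale
[ln Q]. Among so few elements this forces a gap of size [3 tau ln Q] between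
consecutive values of the logarithm of that weight, while those above the gap stay within a
bounded number of such steps of it. *)
Lemma weight_gap (I : eqType) (s : seq I) t (Q tau : R) : 0 < tau -> 1 < Q ->
  uniq s -> (1 < size s)%N -> {in s, forall i, T (t i)} ->
  {in s &, forall i j, i != j -> Q <= expR (dT (t i) (t j))} -> C0 < ln Q ->
  3 * ((size s).+1)%:R * tau <= kappa ->
  exists i0 theta, [/\ exists2 i, i \in s & theta <= ln `|wt i0 (t i)|,
    exists2 j, j \in s & ln `|wt i0 (t j)| < theta &
    {in s, forall i, theta <= ln `|wt i0 (t i)| ->
        ln `|wt i0 (t i)| <= theta + (size s)%:R * (3 * tau * ln Q)} /\
    {in s, forall i, ln `|wt i0 (t i)| < theta -> ln `|wt i0 (t i)| <= theta - 3 * tau * ln Q}].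
Proof.
move=> tau0 Q1 us s2 Ts sep CQ small.
have Q0 : 0 < Q by exact: lt_trans Q1.
have lQ : 0 < ln Q by exact: ln_gt0.
have [i1 [j1 [i1s j1s ij]]] : exists i j, [/\ i \in s, j \in s & i != j].
  case: s us s2 {Ts sep small} => [//|x [//|y s]] /=; rewrite inE negb_or -andbA.
  by case/and3P => xy _ _ _; exists x, y; rewrite !inE !eqxx ?orbT.
have dQ : ln Q <= dT (t i1) (t j1).
  by rewrite -ler_expR lnK ?posrE//; exact: sep.
have [i0 h] := hwt (Ts _ i1s) (Ts _ j1s) (lt_le_trans CQ dQ).
pose Lw i := ln `|wt i0 (t i)|.
have g0 : 0 < 3 * tau * ln Q by rewrite !mulr_gt0.
have hg : (size s).+1%:R * (3 * tau * ln Q) <= `|Lw i1 - Lw j1|.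
  apply: le_trans h; apply: (@le_trans _ _ (kappa * ln Q)); last by rewrite ler_wpM2l ?(ltW hkappa).
  by rewrite mulrA ler_wpM2r ?(ltW lQ)// mulrCA mulrA.
exists i0; rewrite -/(Lw _).
case: (lerP 0 (Lw i1 - Lw j1)) => d; [move: hg; rewrite ger0_norm//|move: hg; rewrite ltr0_norm// opprB].
  by move=> hg; exact: (@gap_split _ _ s Lw _ i1 j1).
by move=> hg; exact: (@gap_split _ _ s Lw _ j1 i1).
Qed.

Lemma equidistributed_weaken k d d' D D' delta delta' :
  (0 < d)%N -> (d <= d')%N -> 0 <= D -> D <= D' -> delta' <= delta ->
  equidistributed k d D delta -> equidistributed k d' D' delta'.
Proof.
move=> d0 dd D0 DD dl h I chi psi s t phi Q ep us sk Q1 sep Ap.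
apply: le_trans (h _ _ _ _ _ _ _ ep us sk Q1 sep Ap) _.
apply: ler_pM; rewrite ?mulr_ge0 ?powR_ge0 ?prod_S_ge0//.
  exact: bound_weaken.
exact: prod_S_mono.
Qed.

Lemma dispersed_sub (I : eqType) Q (s s' : seq I) t : {subset s' <= s} ->
  dispersed Q s t -> dispersed Q s' t.
Proof.
by move=> sub [h1 h2]; split=> [i /sub|i j /sub + /sub]; [exact: h1|exact: h2].
Qed.

(** The gap in the weights cuts the family into a fast and a slow block, both
nonempty and hence covered by the induction hypothesis: for the translates of
the fast block in the averaging step, then for the slow block that remains. The
spread of the fast block is a power of [Q] with exponent proportional to [tau], so
for small [tau] the growth of the norms does not destroy the decay available for
that block. *)
Lemma equidistributed_step k : (0 < k)%N ->
  (exists d D delta, [/\ (d_o <= d)%N, 0 < D, 0 < delta & equidistributed k d D delta]) ->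
  exists d D delta, [/\ (d_o <= d)%N, 0 < D, 0 < delta & equidistributed k.+1 d D delta].
Proof.
move=> k0 [d [D [delta [dd D0 delta0 IH]]]].
have d0 : (0 < d)%N by exact: leq_trans dd.
pose d1 := (d + d_o)%N; pose K := k.+1.
have dd1 : (d <= d1)%N by exact: leq_addr.
have dod1 : (d_o <= d1)%N by exact: leq_addl.
have d10 : (0 < d1)%N by exact: leq_trans dd1.
have b0 := hb d10.
have x1 : 0 <= 2 * b d1 * K%:R * (2 + 3 * K%:R).
  by rewrite !mulr_ge0 ?addr_ge0 ?mulr_ge0.
have x2 : 0 <= 3 * K.+1%:R :> R by rewrite mulr_ge0.
have d2 : 0 < delta / 2 by rewrite divr_gt0.
have [tau tau0 [h1 small]] := small_exponent x1 x2 d2 hkappa.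
have h2 : 2 * b d1 * K%:R * (tau * (2 + 3 * K%:R)) <= delta / 2.
  by apply: le_trans h1; rewrite le_eqVlt; apply/orP; left; apply/eqP; ring.
have [D' [del' [D'0 del'0 core]]] := core_power d0 (ltW D0) delta0 tau0 h2.
pose del := Num.min del' delta.
have del0 : 0 < del by rewrite lt_min del'0.
pose Dn := D' + D + 2 * expR (C0 * del).
have e0 : 0 < 2 * expR (C0 * del) by rewrite mulr_gt0// expR_gt0.
exists d1, Dn, del; split => //; first by rewrite /Dn !addr_gt0.
move=> I chi psi s t phi Q ep us sK Q1 sep Ap.
have Q0 : 0 < Q by exact: lt_le_trans Q1.
have Pge s' := prod_S_ge0 s' d10 Ap.
have DnD : D <= Dn by rewrite /Dn; have := ltW e0; have := ltW D'0; lra.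
have [sk|sk] := leqP (size s) k.
  have dl : del <= delta by rewrite ge_min lexx orbT.
  exact: (equidistributed_weaken d0 dd1 (ltW D0) DnD dl IH ep us sk Q1 sep Ap).
have {}sK : size s = K by apply/eqP; rewrite eqn_leq sK.
(* For bounded [Q] there need not be a gap, but the trivial bound suffices. *)
case: (lerP (ln Q) C0) => [QC|CQ].
  apply: le_trans (trivial_bound s t dod1 ep Ap) _; rewrite ler_wpM2r//.
  apply: (@le_trans _ _ (2 * expR (C0 * del) * Q `^ (- del))); last first.
    by rewrite ler_wpM2r ?powR_ge0// /Dn lerDr ltW// addr_gt0.
  rewrite -mulrA ler_peMr// /powR gt_eqF// -expRD -expR0 ler_expR.
  by rewrite mulrC mulNr -mulrBr mulr_ge0 ?subr_ge0// ltW.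
have Q1' : 1 < Q.
  rewrite lt_neqAle Q1 andbT; apply/eqP => Q1e; move: CQ.
  by rewrite -Q1e ln1 ltNge (ltW hC0).
have Ts : {in s, forall i, T (t i)} by move=> i /(sep.1) [/hTplus].
have s2 : (1 < size s)%N by rewrite sK ltnS.
have small' : 3 * (size s).+1%:R * tau <= kappa by rewrite sK.
have [i0 [theta [[i is_ thi] [j js thj] [hi lo]]]] :=
  weight_gap tau0 Q1' us s2 Ts sep.2 CQ small'.
pose Lw i := ln `|wt i0 (t i)|.
pose sa := [seq i <- s | theta <= Lw i]; pose sb := [seq i <- s | Lw i < theta].
have sub_a : {subset sa <= s} by exact: mem_subseq (filter_subseq _ _).
have sub_b : {subset sb <= s} by exact: mem_subseq (filter_subseq _ _).
have psplit (Rg : comPzRingType) (f : I -> Rg) :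
    \prod_(i <- s) f i = \prod_(i <- sa) f i * \prod_(i <- sb) f i.
  rewrite (bigID (fun i => theta <= Lw i)) !big_filter; congr (_ * _).
  by apply: eq_bigl => x; rewrite ltNge.
have size_ab : (size sa + size sb)%N = size s.
  rewrite !size_filter -(count_predC (fun i => theta <= Lw i)); congr (_ + _)%N.
  by apply: eq_count => x /=; rewrite ltNge.
have sa0 : (0 < size sa)%N by rewrite size_filter -has_count; apply/hasP; exists i.
have sb0 : (0 < size sb)%N by rewrite size_filter -has_count; apply/hasP; exists j.
have sak : (size sa <= k)%N.
  by rewrite -ltnS -/K -sK -size_ab -[X in (X < _)%N]addn0 ltn_add2l.
have sbk : (size sb <= k)%N.
  by rewrite -ltnS -/K -sK -size_ab -[X in (X < _)%N]add0n ltn_add2r.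
have [v [w [tw nw]]] := normalized_vector i0 theta tau Ts Q0.
have QE (x : R) : expR (x * ln Q) = Q `^ x by rewrite /powR gt_eqF.
have Qn0 : Q != 0 by rewrite gt_eqF.
have powM (x y : R) : Q `^ (x + y) = Q `^ x * Q `^ y.
  by rewrite powRD// Qn0 implybT.
have tw' x (y : R) : x \in sa ++ sb -> (t x * e (y *: v))%g = (e (y *: w x) * t x)%g.
  by rewrite mem_cat => xs; apply: tw; case/orP: xs => [/sub_a|/sub_b].
have nwa : {in sa, forall x, Q `^ tau <= normu (w x) <= Q `^ (tau * (1 + 3 * K%:R))}.
  move=> x xa; have xs := sub_a _ xa.
  have thx : theta <= Lw x by move: xa; rewrite mem_filter => /andP[].
  have hx := hi _ xs thx; rewrite (nw _ xs) -/(Lw x); apply/andP; split.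
    by rewrite ler_peMr ?powR_ge0// -expR0 ler_expR subr_ge0.
  have -> : tau * (1 + 3 * K%:R) = tau + K%:R * (3 * tau) by ring.
  rewrite powM ler_wpM2l ?powR_ge0// -QE ler_expR lerBlDl -mulrA.
  by rewrite -sK.
have nwb : {in sb, forall x, normu (w x) <= Q `^ (- (2 * tau))}.
  move=> x xb; have xs := sub_b _ xb.
  have thx : Lw x < theta by move: xb; rewrite mem_filter => /andP[].
  have hx := lo _ xs thx; rewrite (nw _ xs) -/(Lw x).
  have -> : - (2 * tau) = tau + - (3 * tau) by ring.
  rewrite powM ler_wpM2l ?powR_ge0// -QE ler_expR mulNr lerBlDl.
  exact: hx.
have Est (f : I -> X -> R[i]) : (forall i, A (f i)) ->
    normc (cintegral nu (translates sa t f) - \prod_(i <- sa) cintegral mu (f i))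
    <= D * Q `^ (- delta) * \prod_(i <- sa) S d (f i).
  move=> Af; have := IH I _ _ sa t f Q eigenpair1 (filter_uniq _ us) sak Q1
    (dispersed_sub sub_a sep) Af.
  rewrite (_ : (fun x => 1 * _) = translates sa t f); last first.
    by apply/funext => x; rewrite mul1r.
  by rewrite cintegral_cst mul1r.
have [z [z1 zchi] hz] := core I sa sb t phi v w chi psi Q (leqW sak) (leqW sbk) Ap Q1
  tw' nwa nwb Est ep.
have IHb := IH I chi psi sb t phi Q ep (filter_uniq _ us) sbk Q1 (dispersed_sub sub_b sep) Ap.
pose ma := \prod_(i <- sa) cintegral mu (phi i).
pose mb := \prod_(i <- sb) cintegral mu (phi i).
pose Fa := \prod_(i <- sa) S d1 (phi i).
pose Fb := \prod_(i <- sb) S d1 (phi i).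
have -> : \prod_(i <- s) S d1 (phi i) = Fa * Fb by exact: psplit.
have -> : \prod_(i <- s) cintegral mu (phi i) = ma * mb by exact: psplit.
have -> : (fun x => psi x * translates s t phi x) =
    (fun x => psi x * (translates sa t phi x * translates sb t phi x)).
  by apply/funext => x; rewrite /translates psplit.
(* [z] is the mean of the eigenvalues; it is 1 for the constant eigenfunction;
for the others both sides vanish. *)
have mean : cintegral nu psi * (ma * mb) = z * ma * (cintegral nu psi * mb).
  case: (ep_mean ep) => [[_ ->]|[-> /zchi ->]]; first by rewrite !mul0r mulr0.
  by rewrite cintegral_cst !mul1r.
rewrite mean; set J := cintegral nu (fun x => psi x * translates sb t phi x).
apply: le_trans (normc_triangle (z * ma * J) _ _) _.
apply: (@le_trans _ _ (D' * Q `^ (- del') * (Fa * Fb) + D * Q `^ (- delta) * (Fa * Fb))).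
  apply: lerD; first exact: hz.
  rewrite -mulrBr normcM [leRHS](_ : _ = Fa * (D * Q `^ (- delta) * Fb)); last by ring.
  apply: ler_pM; rewrite ?normc_ge0//.
    rewrite normcM -[leRHS]mul1r; apply: ler_pM; rewrite ?normc_ge0//.
    exact: prod_mu_le.
  apply: le_trans IHb _; rewrite ler_wpM2l ?mulr_ge0 ?powR_ge0 ?(ltW D0)//.
  exact: prod_S_mono.
rewrite -mulrDl ler_wpM2r ?mulr_ge0 ?Pge//.
apply: (@le_trans _ _ ((D' + D) * Q `^ (- del))).
  rewrite mulrDl; apply: lerD; apply: bound_weaken => //.
  - exact: ltW.
  - by rewrite ge_min lexx.
  - exact: ltW.
  - by rewrite ge_min lexx orbT.
by rewrite ler_wpM2r ?powR_ge0// /Dn lerDl ltW.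
Qed.

Lemma equidistributed_all k : exists d D delta,
  [/\ (d_o <= d)%N, 0 < D, 0 < delta & equidistributed k.+1 d D delta].
Proof. by elim: k => [|k IH]; [exact: equidistributed1|exact: equidistributed_step]. Qed.

End Induction.

End System.

(** * Summation over the spectrum *)

Section DeltaBounds.
Context (R : realType) (G : Type) (rho : G -> R) (d : G -> G -> R).

Lemma Delta_le_rho r (t : 'I_r.+1 -> G) i : Delta rho d t <= rho (t i).
Proof.
rewrite /Delta; apply: le_trans (bigmin_le _ i _) _.
by rewrite ge_min lexx.
Qed.

Lemma Delta_le_dist r (t : 'I_r.+1 -> G) i j : i != j -> Delta rho d t <= expR (d (t i) (t j)).
Proof.
move=> ij; rewrite /Delta; apply: le_trans (bigmin_le _ i _) _.
rewrite ge_min; apply/orP; right.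
apply: bigmin_le_cond; rewrite eq_sym; exact: ij.
Qed.

Lemma Delta_ge1 r (t : 'I_r.+1 -> G) : (forall i, 1 <= rho (t i)) ->
  (forall i j, 0 <= d (t i) (t j)) -> 1 <= Delta rho d t.
Proof.
move=> h1 h2; apply: le_bigmin => // i _; rewrite le_min h1 /=.
by apply: le_bigmin => // j _; rewrite -expR0 ler_expR.
Qed.

End DeltaBounds.

Section Spectrum.
Context (R : realType) (m : nat) (G : topologicalGroupType) (dX : measure_display)
  (X : measurableType dX) (act : G -> X -> X) (e : 'rV[R]_m -> G) (nu : probability X R)
  (Xi : set ('rV[R]_m -> R[i])) (psi : ('rV[R]_m -> R[i]) -> X -> R[i])
  (hds : discrete_spectrum act e nu Xi psi).

Lemma character_dim0 (xi : 'rV[R]_m -> R[i]) : m = 0%N -> unitary_character xi -> xi = (fun=> 1).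
Proof.
move=> m0 [_ xiD xi1]; apply/funext => v.
have -> : v = 0 by apply/rowP => i; exfalso; have := ltn_ord i; move: (nat_of_ord i) => k; rewrite m0.
have := xiD 0 0; rewrite addr0 => /eqP; rewrite -subr_eq0 -{1}[xi 0]mulr1 -mulrBr mulf_eq0.
move=> /orP[/eqP x0|]; last by rewrite subr_eq0 => /eqP.
by have := xi1 0; rewrite x0 normc0 => /eqP; rewrite eq_sym oner_eq0.
Qed.

Lemma spectrum_one F : measurable_cfun F ->
  cintegral nu (fun x => psi (fun=> 1) x * F x) = cintegral nu (fun x => 1 * F x).
Proof.
move=> mF; have [mp _] := ds_L2 hds (ds_one hds).
apply: ae_eq_cintegral.
- exact: measurable_cfunM.
- exact: (measurable_cfunM (measurable_cfun_cst _ 1) mF).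
- by apply: filterS (ds_psi_one hds) => x ->.
Qed.

Lemma spectrum_eigenpair xi : Xi xi -> xi <> (fun=> 1) -> eigenpair act nu e xi (psi xi).
Proof.
move=> Xxi xi1; have xichar := ds_character hds Xxi.
split.
- by have [] := xichar.
- exact: (ds_L2 hds Xxi).
- have := ds_orthonormal hds Xxi Xxi; rewrite eqxx -nrm2E => -[->].
  exact: lexx.
- by move=> w; exact: (ds_eigen hds w Xxi).
left; split.
  rewrite lt0n; apply/eqP => m0; apply: xi1.
  exact: character_dim0 xichar.
have h := ds_orthonormal hds Xxi (ds_one hds).
rewrite (introF eqP xi1) mulr0n in h; rewrite -[RHS]h.
have [mp _] := ds_L2 hds Xxi.
have [mp1 _] := ds_L2 hds (ds_one hds).
apply: ae_eq_cintegral => //; first by apply: measurable_cfunM => //; exact: measurable_cfun_conj.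
by apply: filterS (ds_psi_one hds) => x ->; rewrite conjC1 mulr1.
Qed.

End Spectrum.
Theorem theorem2p1 (R : realType)
  (* the Lie group G and its exponential map *)
  (n : nat) (G : topologicalGroupType) (atlas : set (chart R n G))
  (hG : lie_group atlas)
  (c0 : chart R n G) (hc0 : atlas c0) (hc01 : chart_dom c0 1%g)
  (expG : 'rV[R]_n -> G) (hexp : exponential_map c0 expG)
  (* the subgroup U, a basis of its Lie algebra u, and a norm on u *)
  (U : set G) (hU : is_subgroup U) (hUclosed : closed U)
  (hUconnected : connected U)
  (m : nat) (uB : 'M[R]_(m, n)) (huB : lie_algebra_basis expG U uB)
  (normu : 'rV[R]_m -> R) (hnormu : is_norm normu)
  (* the subgroup T *)
  (T : set G) (hT : is_subgroup T) (hTclosed : closed T)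
  (hTconnected : connected T)
  (hTabelian : forall s t, T s -> T t -> (s * t = t * s)%g)
  (hTU : forall t u, T t -> U u -> U (t * u * t^-1)%g)
  (hTproper : proper_on T (Ad_mx c0 expG uB))
  (hTdiag : simultaneously_diagonalizable T (Ad_mx c0 expG uB))
  (* the invariant distance on T associated with a norm on Lie(T) *)
  (k : nat) (tB : 'M[R]_(k, n)) (htB : lie_algebra_basis expG T tB)
  (normT : 'rV[R]_k -> R) (hnormT : is_norm normT)
  (dT : G -> G -> R)
  (hdT : invariant_distance T (fun v => expG (v *m tB)) normT dT)
  (* the space X and the measures mu and nu *)
  (dX : measure_display) (X : measurableType dX) (hX : standard_borel R X)
  (act : G -> X -> X) (hact : measurable_action act)
  (mu : probability X R) (hmu : invariant_measure act setT mu)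
  (nu : probability X R) (hnu : invariant_measure act U nu)
  (hnuerg : ergodic_measure act U nu)
  (* discrete spectrum *)
  (Xi : set ('rV[R]_m -> R[i])) (psi : ('rV[R]_m -> R[i]) -> X -> R[i])
  (hds : discrete_spectrum act (fun w => expG (w *m uB)) nu Xi psi)
  (* the algebra and its norms *)
  (A : set (X -> R[i])) (hA : invariant_star_subalgebra act A)
  (S : nat -> (X -> R[i]) -> R) (hS : norm_family A S)
  (d_o : nat) (hd_o : (0 < d_o)%N)
  (* (S1) *)
  (hS1 : forall phi, A phi -> supnorm phi <= S d_o phi)
  (* (S2) *)
  (cA a : R) (hcA : 1 <= cA) (ha : 0 < a)
  (hS2 : forall phi w, A phi ->
    supnorm (fun x => phi (act (expG (w *m uB)) x) - phi x)
      <= cA * normu w `^ a * S d_o phi)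
  (* (S3) *)
  (B b : nat -> R)
  (hB : forall d, (0 < d)%N -> 1 <= B d)
  (hb : forall d, (0 < d)%N -> Num.max (1 / 2) (a / 4) < b d)
  (hS3 : forall d phi w, (0 < d)%N -> A phi ->
    S d (fun x => phi (act (expG (w *m uB)) x))
      <= B d * Num.max 1 (normu w) `^ b d * S d phi)
  (* (S4) *)
  (M : nat -> R) (hM : forall d, (0 < d)%N -> 1 <= M d)
  (hS4 : forall d phi1 phi2, (0 < d)%N -> A phi1 -> A phi2 ->
    S d (fun x => phi1 x * phi2 x)
      <= M d * S (d + d_o)%N phi1 * S (d + d_o)%N phi2)
  (* (S5) and (S6) *)
  (hS56 : convolution_stable act A S)
  (* (EQ1) *)
  (Tplus : set G) (hTplus : Tplus `<=` T)
  (D_o delta_o : R) (hD_o : 1 <= D_o)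
  (hdelta_o : 0 < delta_o < 1)
  (rho : G -> R) (hrho : forall t, Tplus t -> 1 <= rho t)
  (hEQ1 : forall phi t, A phi -> Tplus t ->
    normc (cintegral nu (fun x => phi (act t x)) - cintegral mu phi)
      <= D_o * rho t `^ (- delta_o) * S d_o phi)
  (* (EQ2) *)
  (C c : R) (hC : 1 <= C) (hc : 0 < c < 1 / 2)
  (hEQ2 : forall phi1 phi2 w, A phi1 -> A phi2 ->
    normc (cintegral mu (fun x => phi1 (act (expG (w *m uB)) x) * phi2 x)
             - cintegral mu phi1 * cintegral mu phi2)
      <= C * Num.max 1 (normu w) `^ (- c) * S d_o phi1 * S d_o phi2) :
  forall r : nat,
  exists (d_r : nat) (D_r delta_r : R),
    [/\ (0 < d_r)%N, 0 < D_r, 0 < delta_r &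
      forall (t : 'I_r.+1 -> G) (phi_o : X -> R[i]) (phi : 'I_r.+1 -> X -> R[i]),
        (forall i, Tplus (t i)) -> Wspace nu Xi psi phi_o ->
        (forall i, A (phi i)) ->
        normc (cintegral nu
                 (fun x => phi_o x * \prod_(i < r.+1) phi i (act (t i) x))
                 - cintegral nu phi_o * \prod_(i < r.+1) cintegral mu (phi i))
          <= D_r * Delta rho dT t `^ (- delta_r)
             * fine (Wnorm nu Xi psi phi_o) * \prod_(i < r.+1) S d_r (phi i)].
Proof.
have [_ actM mact'] := hact.
have mact g : measurable_fun setT (act g).
  exact: (measurable_fun_pair2 (g : g_sigma_algebraType (@open G)) mact').
pose e (w : 'rV[R]_m) := expG (w *m uB).
have eD (x y : R) v : e ((x + y) *: v) = (e (x *: v) * e (y *: v))%g.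
  by rewrite /e -!scalemxAl (exp_scaleD hexp).
have hnu' w E : measurable E -> nu (act (e w) @^-1` E) = nu E.
  move=> mE; apply: hnu => //; have [_ h] := huB.
  by have := (h (w *m uB)).1 (submxMl _ _) 1; rewrite scale1r.
have hb' d : (0 < d)%N -> 0 <= b d.
  by move=> d0; have := hb d d0; rewrite gt_max => /andP[h _]; lra.
have c0' : 0 < c by case/andP: hc.
have do0 : 0 < delta_o by case/andP: hdelta_o.
have [P hP hdiag] := hTdiag.
have r0 i : row i P != 0.
  apply/eqP => h; have := mulmxV hP; move=> /(congr1 (row i)).
  rewrite row_mul h mul0mx => /rowP/(_ i); rewrite !mxE eqxx => /esym/eqP.
  by rewrite oner_eq0.
have [C0 [kappa [hC0 hkappa hwt]]] :=
  dist_weights hG hc0 hc01 hexp huB hT hTU hTproper hP hdiag htB hdT.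
have wt0 := weight_neq0 hG hc0 hc01 hexp huB hT hTU hP hdiag.
have wtE := exp_eigen hG hc0 hc01 hexp huB hTU hP hdiag.
move=> r.
have [d [D [delta [dd D0 delta0 main]]]] :=
  equidistributed_all mact actM hmu eD hnu' hnormu hA hS hd_o hS1 hcA ha hS2 hB hb' hS3
    hM hS4 hC c0' hEQ2 hTplus hD_o do0 hEQ1 r0 wt0 wtE hC0 hkappa hwt r.
exists d, D, delta; split => //; first exact: leq_trans dd.
move=> t phi_o phi Tt [[mphi_o bphi_o] Wfin] Aphi.
pose Q := Delta rho dT t; pose s := enum 'I_r.+1.
have prodE (Rg : comPzRingType) (f : 'I_r.+1 -> Rg) : \prod_(i < r.+1) f i = \prod_(i <- s) f i.
  by rewrite big_enum.
have TT i : T (t i) by exact: hTplus.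
have Q1 : 1 <= Q.
  by apply: Delta_ge1 => [i|i j]; [exact: hrho|exact: (dist_ge0 hdT)].
have sep : dispersed Tplus rho dT Q s t.
  split=> [i _|i j _ _ ij]; last exact: Delta_le_dist.
  by split => //; exact: Delta_le_rho.
have size_s : (size s <= r.+1)%N by rewrite size_enum_ord.
have us : uniq s by exact: enum_uniq.
pose F := translates act s t phi.
have mF : measurable_cfun F by exact: (translates_measurable mact hA).
pose B0 := \prod_(i <- s) S d (phi i).
have FB x : normc (F x) <= B0.
  by apply: translates_le => i y; exact: (normc_le_S hA hS hd_o hS1 _ dd).
have d0 : (0 < d)%N by exact: leq_trans dd.
have B00 : 0 <= B0 by exact: (prod_S_ge0 hA hS).
have phi_oL : square_integrable nu phi_o.
  by case: bphi_o => K hK; exact: L2_bdd mphi_o hK.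
have -> : (fun x => phi_o x * \prod_(i < r.+1) phi i (act (t i) x)) = (fun x => phi_o x * F x).
  by apply/funext => x; rewrite prodE.
rewrite !prodE mulrAC -/B0.
apply: (@fourier_bound _ _ _ nu _ Xi psi (ds_L2 hds) (ds_orthonormal hds)
  phi_o F B0 (D * Q `^ (- delta) * B0)) => //.
- move=> eps eps0; have [sq [cq [sX sc]]] := ds_total hds phi_oL eps0.
  exists sq, cq; split=> //.
  have gL : square_integrable nu (fun x => phi_o x - partial_sum psi sq cq x).
    by apply: L2B => //; exact: (partial_sum_L2 (ds_L2 hds)).
  rewrite -lte_fin /nrm2 /Rintegral fineK//.
  exact: (integrable_fin_num measurableT (L2_integrable_sqr gL)).
- by rewrite !mulr_ge0 ?powR_ge0// ltW.
(* The basis element of the trivial character is 1 only almost everywhere. *)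
move=> xi Xxi; have [->|xi1] := pselect (xi = (fun=> 1)); last first.
  exact: (main _ xi (psi xi) s t phi Q (spectrum_eigenpair hds Xxi xi1) us size_s Q1 sep Aphi).
have h1 := main _ _ _ s t phi Q (eigenpair1 _ _ _) us size_s Q1 sep Aphi.
rewrite (spectrum_one hds mF).
have -> : cintegral nu (psi (fun=> 1)) = cintegral nu (fun=> 1).
  have := spectrum_one hds (measurable_cfun_cst _ 1); rewrite mulr1.
  rewrite (_ : (fun x => psi (fun=> 1) x * 1) = psi (fun=> 1)) //.
  by apply/funext => x; rewrite mulr1.
exact: h1.
Qed.
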